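(* Let $b\ge3$ be an integer and let $D=\{kd+a:\ k=0,\dots,l-1\}$ for some integers $a\ge0$, $d\ge1$, $l\ge2$. Assume $D$ is a proper subset of $\{0,\dots,b-1\}$, and let $\nu$ be the natural missing-digit measure on $K_{b,D}$. Then \[ \dim_{\mathrm H}(\nu)\ge\hat\kappa_1(\nu)\ge\dim_{\mathrm H}(\nu)-\frac{\log(4+\log 2l)}{\log b}. \]
   Context: The natural measure $\nu$ on $K_{b,D}$ is the distribution of $\sum_{i\ge1}D_ib^{-i}$ with $D_1,D_2,\dots$ i.i.d. uniform on $D$; $\dim_{\mathrm H}(\nu)$ is the Hausdorff dimension of $\mathrm{supp}(\nu)=K_{b,D}$ (the set of $x\in[0,1]$ having a base-$b$ expansion with digits in $D$). Write $e(x)=e^{2\pi ix}$, $\hat\nu(\xi)=\int_0^1e(-\xi x)\,d\nu(x)$ for $\xi\in\mathbb Z$, and $\hat\kappa_1(\nu)=\sup\{s\ge0:\ \exists C_s\text{ with }\sum_{\xi=0}^Q|\hat\nu(\xi)|\le C_sQ^{1-s}\text{ for all }Q\ge1\}$. $\log$ is the natural logarithm. *)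

(* Defs.v *)
From HB Require Import structures.
From mathcomp Require Import all_boot all_order all_algebra.
From mathcomp Require Import finmap.
From mathcomp Require Import all_classical all_reals all_analysis.
From mathcomp Require Import measurable_realfun complex.

Set Implicit Arguments.
Unset Strict Implicit.
Unset Printing Implicit Defensive.

Import Order.TTheory GRing.Theory Num.Theory.
Import numFieldNormedType.Exports.

Local Open Scope classical_set_scope.
Local Open Scope ring_scope.

Section hausdorff_dimension.
Context {R : realType}.
Implicit Types (A : set R) (s delta : R).
Local Open Scope ereal_scope.

Definition diam A : \bar R :=
  ereal_sup [set `|xy.1 - xy.2|%:E | xy in A `*` A].

(* As 0 `^ 0 = 1, a nonempty set has 0-weight at least 1; the empty set must
   be singled out, since diam set0 = -oo. *)
Definition diam_pow s A : \bar R := if A == set0 then 0 else diam A `^ s.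

Definition hausdorff_premeasure s delta A : \bar R :=
  ereal_inf [set \sum_(0 <= i <oo) diam_pow s (U i) |
    U in [set U : (set R)^nat |
      A `<=` \bigcup_i U i /\ forall i, diam (U i) <= delta%:E]].

Definition hausdorff_measure s A : \bar R :=
  ereal_sup [set hausdorff_premeasure s delta A |
    delta in [set delta : R | (0 < delta)%R]].

Definition hausdorff_dim A : \bar R :=
  ereal_inf [set s%:E |
    s in [set s : R | (0 <= s)%R /\ hausdorff_measure s A = 0]].

End hausdorff_dimension.

Section measures_on_R.
Context {R : realType}.
Implicit Types (mu : set R -> \bar R).

Definition msupport mu : set R :=
  [set x | forall U : set R, open U -> U x -> (0 < mu U)%E].

Definition dimH mu : \bar R := hausdorff_dim (msupport mu).

Definition cexp2pi (x : R) : R[i] :=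
  (cos (2 * pi * x) +i* sin (2 * pi * x))%C.

Definition fourier (nu : {measure set R -> \bar R}) (xi : int) : R[i] :=
  let f x := cexp2pi (- (xi%:~R * x)) in
  ((\int[nu]_(x in `[0, 1]) complex.Re (f x))%R +i*
   (\int[nu]_(x in `[0, 1]) complex.Im (f x))%R)%C.

Definition kappa1 (nu : {measure set R -> \bar R}) : \bar R :=
  ereal_sup [set s%:E | s in [set s : R | 0 <= s /\
    exists C : R, forall Q : nat, (1 <= Q)%N ->
      \sum_(0 <= xi < Q.+1) Normc.normc (fourier nu xi%:Z)
        <= C * Q%:R `^ (1 - s)]].

End measures_on_R.

Section digits.
Context {R : realType}.

(* u i is the coefficient of b ^- (i + 1). *)
Definition digit_sum (b : nat) (u : nat -> nat) : R :=
  limn (series (fun i => (u i)%:R / b%:R ^+ i.+1 : R)).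

Definition missing_digit_set (b : nat) (D : {fset nat}) : set R :=
  [set x | 0 <= x <= 1 /\
    exists u : nat -> nat, (forall i, u i \in D) /\ x = digit_sum b u].

End digits.

Definition arith_digits (a d l : nat) : {fset nat} :=
  [fset (k * d + a)%N | k in iota 0 l]%fset.

Section random_digits.
Context {R : realType} {disp : measure_display} {T : measurableType disp}.
Variable P : probability T R.
Implicit Types (X : nat -> {RV P >-> nat}).

Definition uniform_on (D : {fset nat}) (Y : {RV P >-> nat}) :=
  forall k : nat, P (Y @^-1` [set k]) =
    (if k \in D then (#|` D|%fset%:R)^-1 else 0)%:E.

Definition mutually_independent X :=
  forall (J : {fset nat}) (B : nat -> set nat),
    P (\bigcap_(i in [set` J]) (X i @^-1` B i)) =
    (\prod_(i <- J) P (X i @^-1` B i))%E.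

Definition random_digit_sum (b : nat) X : T -> R :=
  fun t => digit_sum b (fun i => X i t).

Lemma measurable_random_digit_sum b X :
  measurable_fun setT (random_digit_sum b X).
Proof.
set h := fun i t => ((X i t)%:R / b%:R ^+ i.+1 : R).
have h0 i t : 0 <= h i t by rewrite divr_ge0// exprn_ge0.
pose s (t : T) : \bar R := (\sum_(0 <= i <oo) (h i t)%:E)%E.
have ms : measurable_fun [set: T] s.
  rewrite (_ : s = fun t => (\sum_(i <oo | i \in predT) (h i t)%:E)%E)//.
  apply: ge0_emeasurable_sum => [k t _ _|k _]; first by rewrite lee_fin.
  apply/measurable_EFinP.
  rewrite (_ : h k = (fun n : nat => n%:R / b%:R ^+ k.+1 : R) \o X k)//.
  exact: measurableT_comp.
have sE t : s t = limn (EFin \o series (h ^~ t)).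
  by congr (limn _); apply/funext => n; rewrite /= /series/= sumEFin.
rewrite (_ : random_digit_sum b X = fine \o s); first exact: measurableT_comp.
apply/funext => t /=; rewrite sE /random_digit_sum /digit_sum.
have nd : nondecreasing_seq (series (h ^~ t)).
  by apply/nondecreasing_seqP => n; rewrite /series/= big_nat_recr//= lerDl.
have [cv|dv] := pselect (cvgn (series (h ^~ t))); first by rewrite EFin_lim.
rewrite [LHS]dvgP//.
have /cvgeryP/cvg_lim -> // := nondecreasing_dvgn_lt nd dv.
Qed.

HB.instance Definition _ b X :=
  isMeasurableFun.Build _ _ T R (random_digit_sum b X)
    (measurable_random_digit_sum b X).

Definition missing_digit_measure (b : nat) X : probability R R :=
  distribution P (random_digit_sum b X : {RV P >-> R}).

End random_digits.

Section digit_sum_theory.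
Context {R : realType}.
Variable b : nat.
Hypothesis b1 : (1 < b)%N.
Implicit Types u v : nat -> nat.
Let c : R := b%:R.
Let S u n : R := series (fun i => (u i)%:R / c ^+ i.+1) n.

Let c0 : 0 < c. Proof. by rewrite ltr0n ltnW. Qed.

Let S_le u m n : (forall i, u i < b)%N -> (n <= m)%N ->
  S u n <= S u m <= S u n + c ^- n - c ^- m.
Proof.
move=> ub; elim: m => [|m IH].
  by rewrite leqn0 => /eqP ->; rewrite addrK lexx.
rewrite leq_eqVlt => /predU1P[->|]; first by rewrite addrK lexx.
rewrite ltnS => /IH/andP[h1 h2].
have -> : S u m.+1 = S u m + (u m)%:R / c ^+ m.+1.
  by rewrite /S /series/= big_nat_recr.
apply/andP; split.
  by rewrite (le_trans h1)// lerDl divr_ge0// exprn_ge0// ltW.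
have -> : S u n + c ^- n - c ^- m.+1 =
    (S u n + c ^- n - c ^- m) + (c - 1) / c ^+ m.+1.
  rewrite exprS mulrBl mul1r invfM mulrA divff ?gt_eqF//.
  by rewrite mul1r addrA subrK.
apply: lerD => //; apply: ler_wpM2r.
  by rewrite invr_ge0 exprn_ge0// ltW.
by rewrite lerBrDr natr1 ler_nat.
Qed.

Let S_cvg u : (forall i, u i < b)%N -> cvgn (S u).
Proof.
move=> ub; apply: nondecreasing_is_cvgn.
  by move=> m n mn; have /andP[] := S_le ub mn.
exists 1 => _ [n _ <-]; have /andP[_] := S_le ub (leq0n n).
rewrite {2}/S /series/= big_geq// add0r expr0 invr1 => /le_trans; apply.
by rewrite gerBl invr_ge0 exprn_ge0 ?ltW.
Qed.

Lemma digit_sum_bounds u n : (forall i, u i < b)%N ->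
  \sum_(0 <= i < n) (u i)%:R / c ^+ i.+1 <= digit_sum b u
    <= \sum_(0 <= i < n) (u i)%:R / c ^+ i.+1 + c ^- n.
Proof.
move=> ub; rewrite -[X in X <= _ <= X + _]/(S u n); apply/andP; split.
  apply: nondecreasing_cvgn_le; last exact: S_cvg.
  by move=> m k mk; have /andP[] := S_le ub mk.
apply: limr_le; first exact: S_cvg.
exists n => // m /= nm; have /andP[_] := S_le ub nm.
by move=> /le_trans; apply; rewrite gerBl invr_ge0 exprn_ge0 ?ltW.
Qed.

Lemma digit_sum_itv u : (forall i, u i < b)%N -> 0 <= (digit_sum b u : R) <= 1.
Proof.
by move=> /(digit_sum_bounds 0); rewrite big_geq// add0r expr0 invr1.
Qed.

Lemma digit_sum_dist u v n : (forall i, u i < b)%N -> (forall i, v i < b)%N ->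
  (forall i, (i < n)%N -> u i = v i) ->
  `|digit_sum b u - digit_sum b v| <= c ^- n.
Proof.
move=> ub vb uv.
have /andP[u1 u2] := digit_sum_bounds n ub.
have /andP[] := digit_sum_bounds n vb.
rewrite -(@eq_big_nat _ _ _ 0 n (fun i => (u i)%:R / c ^+ i.+1)); last first.
  by move=> i /andP[_ /uv ->].
move=> v1 v2; rewrite ler_norml lerBrDr lerBlDr; apply/andP; split.
  by rewrite addrC lerBlDr (le_trans v2)// lerD2r.
by rewrite (le_trans u2)// addrC lerD2l.
Qed.

Lemma expV_small (eps : R) : 0 < eps -> exists n, c ^- n < eps.
Proof.
move=> e0.
have : `|c^-1| < 1.
  by rewrite gtr0_norm ?invr_gt0// invf_lt1// ltr1n.
move=> /cvg_expr/cvgrPdist_lt/(_ _ e0)[n _ /(_ n (leqnn n))].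
by rewrite sub0r normrN exprVn gtr0_norm ?invr_gt0 ?exprn_gt0// => ?; exists n.
Qed.

Lemma compact_missing_digit_set (D : {fset nat}) :
  [set` D] `<=` `I_b -> compact (missing_digit_set b D : set R).
Proof.
move=> Db.
pose clip u i := minn (u i) b.-1.
have clipb u i : (clip u i < b)%N.
  by rewrite (leq_ltn_trans (geq_minr _ _))// prednK// ltnW.
pose A := [set u : prod_topology (fun _ : nat => nat) |
  forall i, [set` D] (u i)].
have cA : compact A.
  apply: (@tychonoff _ (fun=> nat) (fun=> [set` D])) => i.
  exact/finite_compact/finite_fset.
have clipE u : A u -> clip u = u.
  move=> Au; apply/funext => i; rewrite /clip; apply/minn_idPl.
  by rewrite -ltnS prednK// ?(ltnW b1)//; exact: Db.
pose g (u : prod_topology (fun _ : nat => nat)) : R := digit_sum b (clip u).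
have -> : missing_digit_set b D = g @` A.
  apply/seteqP; split => [x [_ [u [uD ->]]]|_ [u Au <-]].
    by exists u => //; rewrite /g clipE.
  split; first exact: digit_sum_itv.
  by exists u; split=> [i|]; [exact: Au|rewrite /g clipE].
apply: continuous_compact => //; apply: continuous_subspaceT => u.
apply/cvgrPdist_lt => /= eps e0; have [n ne] := expV_small e0.
have : \forall v \near u, forall i, (i < n)%N -> u i = v i.
  elim: n {ne} => [|n IH]; first by near=> v.
  have : \forall v \near u, u n = v n.
    have /(_ [set u n]) := @proj_continuous nat (fun=> nat) n u.
    move=> /(_ (discrete_set1 _)); apply: filterS => v /=.
    by move=> ->.
  apply: filterS2 IH => v vn uvn i; rewrite ltnS leq_eqVlt => /predU1P[->//|].
  exact: vn.
apply: filterS => v uv; rewrite (le_lt_trans _ ne)//.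
by apply: digit_sum_dist => // i /uv; rewrite /clip => ->.
Unshelve. all: by end_near. Qed.

End digit_sum_theory.

Section support.
Context {R : realType} {disp : measure_display} {T : measurableType disp}.
Variable P : probability T R.

Lemma msupport_missing_digit_measure b (D : {fset nat})
    (X : nat -> {RV P >-> nat}) : (1 < b)%N -> [set` D] `<=` `I_b ->
  (forall i, uniform_on D (X i)) -> mutually_independent X ->
  msupport (missing_digit_measure b X) = missing_digit_set b D.
Proof.
move=> b1 Db uX iX.
pose N := [set t | exists i, X i t \notin D].
have mX i (B : set nat) : measurable (X i @^-1` B).
  by rewrite -[X in measurable X]setTI; exact: measurable_funPT.
have mN : measurable N.
  rewrite (_ : N = \bigcup_i (X i @^-1` ~` [set` D])); last first.
    by apply/seteqP; split => [t [i /negP it]|t [i _ /negP it]]; exists i.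
  exact: bigcupT_measurable.
have PN : P N = 0%E.
  apply: measure_negligible => //.
  apply: (@negligibleS _ _ _ _ (\bigcup_i \bigcup_k
    if k \in D then set0 else X i @^-1` [set k])).
    by move=> t [i it]; exists i => //; exists (X i t); rewrite // (negbTE it).
  apply: negligible_bigcup => i; apply: negligible_bigcup => k.
  case: ifPn => kD; first exact: negligible_set0.
  by have := uX i k; rewrite (negbTE kD) => Pk; apply/(negligibleP P (mX i _)).
have NP t : ~ N t -> forall i, X i t \in D.
  by move=> nt i; apply/negPn/negP => h; apply: nt; exists i.
have nuE U : missing_digit_measure b X U = P (random_digit_sum b X @^-1` U).
  by [].
have mpre U : open U -> measurable (random_digit_sum b X @^-1` U).
  move=> oU; rewrite -[X in measurable X]setTI.
  by apply: measurable_random_digit_sum => //; exact: open_measurable.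
apply/seteqP; split => [x|_ [_ [u [uD ->]]] U oU Ux].
  apply: contraPP => xK /(_ (~` missing_digit_set b D)); apply/not_implyP.
  have oK : open (~` (missing_digit_set b D : set R)).
    rewrite openC; apply: compact_closed; first exact: Rhausdorff.
    exact: compact_missing_digit_set.
  split=> // /(_ xK); rewrite nuE; apply/negP; rewrite -leNgt -PN.
  apply: le_measure; rewrite ?inE//; first exact: mpre.
  move=> t /=; apply: contra_notP => /NP Xt; split; last by exists (X ^~ t).
  by apply: digit_sum_itv => // i; exact: Db (Xt i).
have /nbhs_ballP[eps /= e0 eU] : nbhs (digit_sum b u : R) U.
  exact: open_nbhs_nbhs.
have [n ne] := expV_small b1 e0.
pose J : {fset nat} := [fset i in iota 0 n]%fset.
pose E := \bigcap_(i in [set` J]) (X i @^-1` [set u i]).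
have mE : measurable E by exact: bigcap_measurableType.
have PE : (0 < P E)%E.
  rewrite /E iX; elim/big_ind : _ => //; first by move=> *; exact: mule_gt0.
  move=> i _; rewrite uX uD lte_fin invr_gt0 ltr0n cardfs_gt0.
  by apply/fset0Pn; exists (u i).
apply: (lt_le_trans PE).
have -> : P E = P (E `\` N).
  have PEoo : (P E < +oo)%E.
    by rewrite (le_lt_trans (probability_le1 _ _))// ltry.
  rewrite (measureD mE mN PEoo).
  rewrite [X in (_ - X)%E](_ : _ = 0%E) ?sube0//.
  apply/eqP; rewrite -measure_le0 -PN le_measure ?inE//.
  exact: measurableI.
apply: le_measure; rewrite ?inE//; [exact: measurableD|exact: mpre|].
move=> t [Et /NP Xt]; apply: eU; rewrite /ball/= (le_lt_trans _ ne)//.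
apply: digit_sum_dist => // [i|i|i ni]; [exact: Db (uD i)|exact: Db (Xt i)|].
by apply/esym/Et; rewrite /= !inE mem_iota.
Qed.

End support.

(* Main.v *)
(* If sum_(xi <= Q) |nu^(xi)| <= C Q^(1-s), then integrating Fejer's kernel
   against nu gives nu [c - r, c + r] = O(r^s), and the mass distribution
   principle yields dim_H (supp nu) >= s.

   Conversely, the covers by cylinders give dim_H K <= log l / log b, while
   |nu^(xi)| <= prod_(i <= n) |D_l (d xi / b^i)| / l with D_l the Dirichlet
   kernel.  Writing xi = xi' + t b^(n-1), only the factor i = n depends on
   the leading digit t, so the sum over xi < b^n is at most M^n, where M bounds
   (1/l) sum_(t < b) |D_l (d (x + t / b))|.  With b' = b / gcd (d, b) >= l, the
   points d (x + t / b) run, modulo 1, gcd (d, b) times over a translate of the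
   grid (1/b') Z, and |D_l y| <= min (l, 1 / (2 ||y||)) gives
   M <= (b / l) (4 + log (2 l)).  Hence kappa_1 >= 1 - log_b M. *)

Require Import Defs.
From HB Require Import structures.
From mathcomp Require Import all_boot all_order all_algebra.
From mathcomp Require Import finmap.
From mathcomp Require Import all_classical all_reals all_analysis.
From mathcomp Require Import measurable_realfun complex.
From mathcomp Require Import ring lra zify.

Set Implicit Arguments.
Unset Strict Implicit.
Unset Printing Implicit Defensive.

Import Order.TTheory GRing.Theory Num.Theory.
Import numFieldNormedType.Exports.
Import Normc.

Local Open Scope classical_set_scope.
Local Open Scope ring_scope.

Section complex_modulus.
Context {R : rcfType}.
Implicit Types (z : R[i]) (x y : R).

Lemma normc_ge0 z : 0 <= normc z.
Proof. exact: (@normr_ge0 R (Rcomplex R)). Qed.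

Lemma normc_sum (I : Type) (r : seq I) (Q : pred I) (F : I -> R[i]) :
  normc (\sum_(i <- r | Q i) F i) <= \sum_(i <- r | Q i) normc (F i).
Proof. exact: (@ler_norm_sum R (Rcomplex R)). Qed.

Lemma normc_prod (I : Type) (r : seq I) (Q : pred I) (F : I -> R[i]) :
  normc (\prod_(i <- r | Q i) F i) = \prod_(i <- r | Q i) normc (F i).
Proof. exact: (big_morph _ (@normcM R) (normc1 R)). Qed.

Lemma normc_real_complex x : normc (x%:C)%C = `|x|.
Proof. by rewrite /normc/= expr0n addr0 sqrtr_sqr. Qed.

Lemma normc_conj z : normc (z^*)%C = normc z.
Proof. by case: z => x y; rewrite /normc/= sqrrN. Qed.

Lemma sqr_normcE z : normc z ^+ 2 = complex.Re z ^+ 2 + complex.Im z ^+ 2.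
Proof. by case: z => x y; rewrite sqr_sqrtr// addr_ge0 ?sqr_ge0. Qed.

Lemma Re_le_normc z : complex.Re z <= normc z.
Proof.
apply: le_trans (ler_norm _) _.
rewrite -ler_sqr ?nnegrE ?normc_ge0// sqr_normcE real_normK ?num_real//.
by rewrite lerDl sqr_ge0.
Qed.

Lemma normc_le_Re_Im z : normc z <= `|complex.Re z| + `|complex.Im z|.
Proof.
rewrite -ler_sqr ?nnegrE ?normc_ge0 ?addr_ge0// sqr_normcE.
by rewrite sqrrD !real_normK ?num_real// addrAC lerDl mulrn_wge0// mulr_ge0.
Qed.

End complex_modulus.

Section complex_exponential.
Context {R : realType}.
Implicit Types (x y : R) (n : nat).

Lemma cexp2piD x y : cexp2pi (x + y) = cexp2pi x * cexp2pi y.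
Proof.
by rewrite /cexp2pi mulrDr cosD sinD; congr (_ +i* _)%C; rewrite addrC.
Qed.

Lemma cexp2pi0 : cexp2pi 0 = 1 :> R[i].
Proof. by rewrite /cexp2pi mulr0 cos0 sin0. Qed.

Lemma cexp2piN x : cexp2pi (- x) = (cexp2pi x)^*%C.
Proof. by rewrite /cexp2pi/= mulrN cosN sinN. Qed.

Lemma cexp2pi_sum (I : Type) (r : seq I) (Q : pred I) (F : I -> R) :
  cexp2pi (\sum_(i <- r | Q i) F i) = \prod_(i <- r | Q i) cexp2pi (F i).
Proof. exact: (big_morph _ cexp2piD cexp2pi0). Qed.

Lemma cexp2piMn n x : cexp2pi (n%:R * x) = cexp2pi x ^+ n.
Proof.
rewrite mulr_natl -[n in LHS]card_ord -sumr_const cexp2pi_sum.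
by rewrite prodr_const card_ord.
Qed.

Lemma cexp2pi_nat n : cexp2pi n%:R = 1 :> R[i].
Proof.
by rewrite -[n%:R]mulr1 cexp2piMn /cexp2pi mulr1 mulr_natl cos2pi sin2pi expr1n.
Qed.

Lemma normc_cexp2pi x : normc (cexp2pi x) = 1.
Proof. by rewrite /cexp2pi /normc cos2Dsin2 sqrtr1. Qed.

Lemma normc_cexp2piB1 x : normc (cexp2pi x - 1) = 2 * `|sin (pi * x)|.
Proof.
apply/eqP; rewrite -(@eqrXn2 _ 2) ?mulr_ge0 ?normc_ge0//; apply/eqP.
rewrite sqr_normcE/= subr0 exprMn real_normK ?num_real//.
have -> : 2 * pi * x = pi * x *+ 2 by rewrite -mulrA mulr_natl.
by rewrite [X in _ + X]sin2cos2 cos_mulr2n sin2cos2; ring.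
Qed.

Lemma continuous_Re_cexp2pi : continuous (fun x => complex.Re (cexp2pi x)).
Proof.
move=> x; apply: (@continuous_comp _ _ _ ( *%R (2 * pi))).
  exact: mulrl_continuous.
exact: continuous_cos.
Qed.

Lemma continuous_Im_cexp2pi : continuous (fun x => complex.Im (cexp2pi x)).
Proof.
move=> x; apply: (@continuous_comp _ _ _ ( *%R (2 * pi))).
  exact: mulrl_continuous.
exact: continuous_sin.
Qed.

Lemma norm_Re_cexp2pi_le1 x : `|complex.Re (cexp2pi x)| <= 1.
Proof. exact: cos_max. Qed.

Lemma norm_Im_cexp2pi_le1 x : `|complex.Im (cexp2pi x)| <= 1.
Proof. exact: sin_max. Qed.

End complex_exponential.

Section dirichlet_kernel.
Context {R : realType}.
Implicit Types (x y : R) (n l N : nat).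

Lemma cos_ge1B x : 1 - `|x| <= cos x.
Proof.
rewrite -cos_norm; have ccos : {within `[0, `|x|], continuous (@cos R)}.
  by apply: continuous_subspaceT => ?; exact: continuous_cos.
have dcos (t : R) : t \in `]0, `|x|[ -> is_derive t 1 cos (- sin t).
  by move=> _; exact: is_derive_cos.
have [t _ /eqP] := MVT_segment (normr_ge0 x) dcos ccos.
rewrite cos0 subr0 subr_eq => /eqP ->.
by rewrite mulNr [leRHS]addrC lerD2l lerN2 ler_piMl// sin_le1.
Qed.

(* As [cos] decreases, [sin] has larger slope on the left of [x] than on the
   right; both slopes cannot be below [2 / pi], the slope of the whole chord. *)
Lemma sin_ge_chord x : 0 <= x <= pi / 2 -> 2 / pi * x <= sin x.
Proof.
have sin_mvt (u v : R) : u < v ->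
    exists2 t, t \in `]u, v[ & sin v - sin u = cos t * (v - u).
  move=> uv; apply: MVT => //.
  by apply: continuous_subspaceT => ?; exact: continuous_sin.
have pi_gt0 : 0 < pi :> R := pi_gt0 R.
have chordE : 2 / pi * (pi / 2) = 1 :> R.
  by rewrite mulrA divfK ?divff// gt_eqF.
rewrite le_eqVlt => /andP[/predU1P[<- _|x_gt0]]; first by rewrite mulr0 sin0.
rewrite le_eqVlt => /predU1P[->|x_lt]; first by rewrite chordE sin_pihalf.
have [s] := sin_mvt _ _ x_gt0; have [t] := sin_mvt _ _ x_lt.
rewrite !in_itv/= sin0 sin_pihalf !subr0 => /andP[xt t_lt] right_slope.
move=> /andP[s_gt0 sx] left_slope.
have cos_ts : cos t < cos s by rewrite ltr_cos ?in_itv/=; lra.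
rewrite left_slope ler_pM2r// leNgt; apply/negP => cos_s.
by move: chordE right_slope; rewrite left_slope; nra.
Qed.

Lemma sin_pi_ge x : 0 <= x <= 2^-1 -> 2 * x <= sin (pi * x).
Proof.
move=> /andP[x_ge0 x_le]; have pi_gt0 : 0 < pi :> R := pi_gt0 R.
have -> : 2 * x = 2 / pi * (pi * x) by rewrite mulrA divfK// gt_eqF.
by apply: sin_ge_chord; rewrite mulr_ge0 ?ler_pM2l// ltW.
Qed.

Definition dirichlet l x : R := normc (\sum_(k < l) cexp2pi (k%:R * x)).

Lemma dirichlet_ge0 l x : 0 <= dirichlet l x.
Proof. exact: normc_ge0. Qed.

Lemma dirichlet_le l x : dirichlet l x <= l%:R.
Proof.
rewrite (le_trans (normc_sum _ _ _))// (eq_bigr (fun=> 1)).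
  by rewrite sumr_const card_ord.
by move=> k _; rewrite normc_cexp2pi.
Qed.

Lemma dirichletDn l x n : dirichlet l (x + n%:R) = dirichlet l x.
Proof.
congr normc; apply: eq_bigr => k _.
by rewrite mulrDr cexp2piD -natrM cexp2pi_nat mulr1.
Qed.

Lemma dirichletN l x : dirichlet l (- x) = dirichlet l x.
Proof.
rewrite /dirichlet -[RHS]normc_conj rmorph_sum/=; congr normc.
by apply: eq_bigr => k _; rewrite mulrN cexp2piN.
Qed.

Lemma dirichlet_le_inv l x : 0 < x <= 2^-1 -> dirichlet l x <= (2 * x)^-1.
Proof.
move=> /andP[x_gt0 x_le].
have sin_ge : 2 * x <= sin (pi * x) by apply: sin_pi_ge; rewrite ltW.
have sin_gt0 : 0 < sin (pi * x) by rewrite (lt_le_trans _ sin_ge)// mulr_gt0.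
have geometric : 2 * sin (pi * x) * dirichlet l x <= 2 * 1.
  rewrite -{1}[sin _]gtr0_norm// -normc_cexp2piB1 -normcM.
  under eq_bigr do rewrite cexp2piMn.
  by rewrite -subrX1 -cexp2piMn normc_cexp2piB1 ler_wpM2l// sin_max.
rewrite -[leRHS]mul1r ler_pdivlMr ?mulr_gt0// mulrC.
apply: (@le_trans _ _ (sin (pi * x) * dirichlet l x)); last by lra.
by rewrite ler_wpM2r// dirichlet_ge0.
Qed.

Lemma dirichlet_ge_half N x : `|x| * N%:R <= 16^-1 -> N%:R / 2 <= dirichlet N x.
Proof.
move=> xN; apply: le_trans (Re_le_normc _); rewrite raddf_sum/=.
rewrite mulrC mulr_natr -[X in _ *+ X]card_ord -sumr_const ler_sum// => k _.
rewrite /cexp2pi/= (le_trans _ (cos_ge1B _))//.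
have kx : k%:R * `|x| <= 16^-1.
  by rewrite (le_trans _ xN)// mulrC ler_wpM2l// ler_nat ltnW.
rewrite !normrM (ger0_norm (pi_ge0 R)) !normr_nat -mulrA.
by have := pihalf_lt2 R; have := pi_gt0 R; nra.
Qed.

Lemma sqr_dirichlet N x : dirichlet N x ^+ 2 =
  \sum_(j < N) \sum_(k < N) complex.Re (cexp2pi (`|j - k|%N%:R * x)).
Proof.
rewrite sqr_normcE !raddf_sum/= !expr2 !big_distrlr/= -big_split/=.
apply: eq_bigr => j _; rewrite -big_split/=; apply: eq_bigr => k _.
rewrite -cosB -mulrBr -mulrBl.
have [jk|/ltnW kj] := leqP k j; first by rewrite distnEl// natrB.
by rewrite distnEr// natrB// -cosN -mulrN -mulNr opprB.
Qed.

End dirichlet_kernel.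

Section harmonic_sum.
Context {R : realType}.
Implicit Types m n : nat.

Lemma invS_le_lnB n : (0 < n)%N ->
  n.+1%:R^-1 <= ln n.+1%:R - ln n%:R :> R.
Proof.
move=> n_gt0; rewrite -opprB -ln_div ?posrE ?ltr0n// lerNr.
have -> : n%:R / n.+1%:R = 1 + - n.+1%:R^-1 :> R.
  by rewrite -natr1; field; rewrite natr1 gt_eqF// ltr0n.
by apply: le_ln1Dx; rewrite ltrN2 invf_lt1 ?ltr1n ?ltr0n.
Qed.

Lemma sum_inv_le_ln m n : (0 < m <= n)%N ->
  \sum_(m <= j < n.+1) (j%:R : R)^-1 <= m%:R^-1 + (ln n%:R - ln m%:R).
Proof.
move=> /andP[m_gt0 mn]; rewrite big_nat_recl// lerD2l.
rewrite -(telescope_sumr (fun j => ln j%:R)) ?ler_sum_nat// => j /andP[mj _].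
by apply: invS_le_lnB; apply: leq_trans mj.
Qed.

End harmonic_sum.

Section dirichlet_sum.
Context {R : realType}.
Implicit Types (x y : R) (l n : nat).

(* This is [min l (1 / (2 x))], with value [l] at [x = 0]. *)
Definition dirichlet_bound l x : R :=
  if 2 * x * l%:R <= 1 then l%:R else (2 * x)^-1.

Lemma dirichlet_bound_ge0 l x : 0 <= x -> 0 <= dirichlet_bound l x.
Proof.
move=> x_ge0; rewrite /dirichlet_bound.
by case: ifP; rewrite ?invr_ge0 ?mulr_ge0.
Qed.

Lemma dirichlet_bound_le l x : 0 <= x -> dirichlet_bound l x <= l%:R.
Proof.
rewrite /dirichlet_bound le_eqVlt => /predU1P[<-|x_gt0].
  by rewrite mulr0 mul0r ler01.
case: ifPn => //; rewrite -ltNge => /ltW; rewrite -ler_pdivrMl ?mulr_gt0//.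
by rewrite mulr1.
Qed.

Lemma dirichlet_bound_le_inv l x : 0 < x -> dirichlet_bound l x <= (2 * x)^-1.
Proof.
move=> x_gt0; rewrite /dirichlet_bound; case: ifP => // small.
by rewrite -[leRHS]mulr1 ler_pdivlMl ?mulr_gt0.
Qed.

Lemma dirichlet_le_bound l x y : 0 <= x <= y -> y <= 2^-1 ->
  dirichlet l y <= dirichlet_bound l x.
Proof.
move=> /andP[x_ge0 xy] y_le; rewrite /dirichlet_bound.
case: ifPn => [_|]; first exact: dirichlet_le.
rewrite -ltNge => large.
have x_gt0 : 0 < x.
  rewrite lt0r x_ge0 andbT; apply: contraTneq large => ->.
  by rewrite mulr0 mul0r ltr10.
have y_gt0 := lt_le_trans x_gt0 xy.
rewrite (le_trans (dirichlet_le_inv _ _)) ?y_gt0//.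
by rewrite lef_pV2 ?posrE ?mulr_gt0// ler_pM2l.
Qed.

Lemma sum_dirichlet_bound_le l n : (1 < l <= n)%N ->
  \sum_(0 <= j < n) dirichlet_bound l (j%:R / n%:R) <=
    l%:R + n%:R + n%:R / 2 * ln (2 * l%:R).
Proof.
move=> /andP[l_gt1 l_le_n].
have n_gt0 : 0 < n%:R :> R by rewrite ltr0n; lia.
(* Below [m] the bound [l] is the smaller one, above it [n / (2 j)]. *)
pose m := (n %/ (2 * l)).+1.
have m_lt_n : (m < n)%N by rewrite /m; nia.
have n_lt : (n < m * (2 * l))%N by apply: ltn_ceil; lia.
have head_le : \sum_(0 <= j < m) dirichlet_bound l (j%:R / n%:R) <=
    l%:R + n%:R / 2.
  apply: (@le_trans _ _ (\sum_(0 <= j < m) l%:R)).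
    by apply: ler_sum => j _; rewrite dirichlet_bound_le ?divr_ge0.
  rewrite sumr_const_nat subn0 mulrSr addrC lerD2l.
  by rewrite -[leLHS]mulr_natr ler_pdivlMr// -!natrM ler_nat; nia.
have tail_le : \sum_(m <= j < n) dirichlet_bound l (j%:R / n%:R) <=
    n%:R / 2 + n%:R / 2 * ln (2 * l%:R).
  apply: (@le_trans _ _ (n%:R / 2 * \sum_(m <= j < n) j%:R^-1)).
    rewrite mulr_sumr; apply: ler_sum_nat => j /andP[mj _].
    have j_gt0 : 0 < j%:R :> R by rewrite ltr0n (leq_trans _ mj).
    apply: le_trans (dirichlet_bound_le_inv _ _) _; first by rewrite divr_gt0.
    by rewrite !invfM invrK mulrCA mulrC [2^-1 * _]mulrC.
  rewrite -{2}[n%:R / 2]mulr1 -mulrDr ler_wpM2l ?divr_ge0//.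
  have m_le_n : (m <= n)%N := ltnW m_lt_n.
  apply: (@le_trans _ _ (\sum_(m <= j < n.+1) j%:R^-1)).
    by rewrite big_nat_recr//= lerDl invr_ge0.
  apply: (le_trans (sum_inv_le_ln _)) => //.
  apply: lerD; first by rewrite invf_le1 ?ler1n.
  rewrite lerBlDl -lnM ?posrE ?mulr_gt0 ?ltr0n//; try lia.
  rewrite ler_ln ?posrE ?mulr_gt0 ?ltr0n//; try lia.
  by rewrite -!natrM ler_nat; lia.
rewrite (@big_cat_nat _ _ _ m)//=; last exact: ltnW.
by apply: le_trans (lerD head_le tail_le) _; lra.
Qed.

Lemma sum_dirichlet_grid_le l n y : (1 < l <= n)%N -> 0 <= y < n%:R^-1 ->
  \sum_(0 <= t < n) dirichlet l (y + t%:R / n%:R) <=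
    n%:R * (4 + ln (2 * l%:R)).
Proof.
move=> l_itv /andP[y_ge0 y_lt]; have /andP[l_gt1 l_le_n] := l_itv.
have n_gt0 : 0 < n%:R :> R by rewrite ltr0n; lia.
pose B j : R := dirichlet_bound l (j%:R / n%:R).
have B_ge0 j : 0 <= B j by rewrite dirichlet_bound_ge0 ?divr_ge0.
have grid_le t : (t < n)%N ->
    dirichlet l (y + t%:R / n%:R) <= B t + B (n - t.+1)%N.
  move=> t_lt; set x := y + _.
  have [x_le|x_gt] := leP x 2^-1.
    by rewrite ler_wpDr// dirichlet_le_bound// divr_ge0//= lerDr.
  rewrite -dirichletN -(dirichletDn _ _ 1) addrC ler_wpDl//.
  apply: dirichlet_le_bound; last by lra.
  rewrite divr_ge0//= natrB// mulrBl divff ?gt_eqF// lerD2l lerN2.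
  by rewrite /x -natr1 mulrDl mul1r addrC lerD2l ltW.
apply: (@le_trans _ _ (\sum_(0 <= t < n) (B t + B (n - t.+1)%N))).
  by apply: ler_sum_nat => t /andP[_]; exact: grid_le.
have B_rev : \sum_(0 <= t < n) B (n - t.+1)%N = \sum_(0 <= t < n) B t.
  by rewrite [RHS]big_nat_rev.
have l_le_nR : l%:R <= n%:R :> R by rewrite ler_nat.
have B_le : \sum_(0 <= t < n) B t <= _ := sum_dirichlet_bound_le l_itv.
rewrite big_split/= B_rev; move: B_le l_le_nR.
by set S := \sum_(_ <= _ < _) _; set L := ln _; lra.
Qed.

End dirichlet_sum.

Lemma eqn_mod_coprimeMl d n i j : coprime d n ->
  (d * i == d * j %[mod n]) = (i == j %[mod n]).
Proof.
move=> dn; wlog le_ij : i j / (j <= i)%N.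
  move=> hwlog; have [/hwlog//|/ltnW/hwlog] := leqP j i.
  by rewrite eq_sym [RHS]eq_sym.
rewrite !eqn_mod_dvd ?leq_mul2l ?le_ij ?orbT//.
by rewrite -mulnBr Gauss_dvdr// coprime_sym.
Qed.

Section periodic_sums.
Context {V : nmodType}.
Implicit Types (F : nat -> V) (d m n k z : nat).

Lemma sum_blocks F m k :
  \sum_(0 <= t < m * k) F t =
    \sum_(0 <= j < k) \sum_(0 <= t < m) F (t + m * j)%N.
Proof.
rewrite mulnC big_nat_mul; apply: eq_bigr => j _.
by rewrite -{1}[(j * m)%N]add0n big_addn mulSn addnK mulnC.
Qed.

Lemma sum_periodic F n k : (forall t, F (t + n)%N = F t) ->
  \sum_(0 <= t < n * k) F t = (\sum_(0 <= t < n) F t) *+ k.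
Proof.
move=> F_periodic; rewrite sum_blocks.
rewrite (eq_bigr (fun=> \sum_(0 <= t < n) F t)) ?sumr_const_nat ?subn0// => j _.
apply: eq_bigr => t _; elim: j => [|j IH]; first by rewrite muln0 addn0.
by rewrite mulnS (addnC n) addnA F_periodic.
Qed.

Lemma sum_affine_modn F d z n : coprime d n -> (0 < n)%N ->
  \sum_(0 <= t < n) F ((z + d * t) %% n)%N = \sum_(0 <= t < n) F t.
Proof.
move=> dn n_gt0; rewrite !big_mkord.
pose affine (t : 'I_n) : 'I_n := Ordinal (ltn_pmod (z + d * t) n_gt0).
rewrite [RHS](reindex_inj (h := affine))// => i j /(congr1 val)/= /eqP.
by rewrite eqn_modDl eqn_mod_coprimeMl// !modn_small// => /eqP/val_inj.
Qed.

End periodic_sums.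

(* As [f i] depends only on the lowest [i.+1] base-[b] digits of its argument,
   summing over the leading digit [t] first peels off the last factor. *)
Lemma sum_prod_digits_le (R : realDomainType) (f : nat -> nat -> R) b M n :
  (forall i k, 0 <= f i k) ->
  (forall i m k t, (i < m)%N -> f i (k + b ^ m * t)%N = f i k) ->
  (forall m k, \sum_(0 <= t < b) f m (k + b ^ m * t)%N <= M) ->
  \sum_(0 <= k < b ^ n) \prod_(i < n) f i k <= M ^+ n.
Proof.
move=> f_ge0 f_low f_sum.
have M_ge0 : 0 <= M by apply: le_trans (f_sum 0%N 0%N); exact: sumr_ge0.
elim: n => [|n IH]; first by rewrite expn0 big_nat1 big_ord0 expr0.
rewrite expnSr sum_blocks exchange_big/= exprSr.
apply: (@le_trans _ _ (\sum_(0 <= k < b ^ n) (\prod_(i < n) f i k) * M)).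
  apply: ler_sum => k _; apply: le_trans (ler_wpM2l _ (f_sum n k)).
    rewrite mulr_sumr le_eqVlt; apply/predU1l/eq_bigr => t _.
    rewrite big_ord_recr/=; congr *%R.
    by apply: eq_bigr => i _; exact: f_low.
  exact: prodr_ge0.
by rewrite -mulr_suml ler_wpM2r.
Qed.

Section dirichlet_progression.
Context {R : realType}.
Implicit Types (l b d n : nat) (x y : R).

(* With [g = gcd d b], the points [d * (x + t / b)] run, modulo 1, [g] times
   over a translate of the grid of step [1 / (b / g)]. *)
Lemma sum_periodic_progression (F : R -> R) b d x :
  (forall y n, F (y + n%:R) = F y) -> (0 < b)%N -> 0 <= x ->
  let n := (b %/ gcdn d b)%N in
  exists2 y, 0 <= y < n%:R^-1 &
    \sum_(0 <= t < b) F (d%:R * (x + t%:R / b%:R)) =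
      (\sum_(0 <= t < n) F (y + t%:R / n%:R)) *+ gcdn d b.
Proof.
move=> F_periodic b_gt0 x_ge0 n; set g := gcdn d b; pose e := (d %/ g)%N.
have g_gt0 : (0 < g)%N by rewrite gcdn_gt0 b_gt0 orbT.
have bE : b = (n * g)%N by rewrite divnK// dvdn_gcdr.
have dE : d = (e * g)%N by rewrite divnK// dvdn_gcdl.
have n_gt0 : (0 < n)%N by rewrite divn_gt0// dvdn_leq// dvdn_gcdr.
have e_coprime_n : coprime e n.
  by rewrite /coprime -(eqn_pmul2r g_gt0) muln_gcdl -dE -bE mul1n.
have nR_gt0 : 0 < n%:R :> R by rewrite ltr0n.
have gR_gt0 : 0 < g%:R :> R by rewrite ltr0n.
have dxn_ge0 : 0 <= d%:R * x * n%:R by rewrite !mulr_ge0.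
pose z := Num.truncn (d%:R * x * n%:R).
have /andP[z_le z_gt] := truncn_itv dxn_ge0; rewrite -/z in z_le z_gt.
pose y : R := d%:R * x - z%:R / n%:R.
exists y.
  rewrite subr_ge0 ler_pdivrMr// z_le/= ltrBlDr.
  by rewrite -(ltr_pM2r nR_gt0) mulrDl mulVf ?divfK ?gt_eqF// addrC natr1.
pose G t := F (y + t%:R / n%:R).
have progressionE t : F (d%:R * (x + t%:R / b%:R)) = G ((z + e * t) %% n)%N.
  rewrite /G -[RHS](F_periodic _ ((z + e * t) %/ n)%N); congr F.
  have -> : d%:R * (x + t%:R / b%:R) = y + (z + e * t)%:R / n%:R.
    rewrite /y mulrDr natrD natrM mulrDl addrA subrK; congr +%R.
    by rewrite {1}dE bE !natrM; field; rewrite ?gt_eqF.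
  rewrite {1}(divn_eq (z + e * t) n) natrD natrM mulrDl mulfK ?gt_eqF//.
  by rewrite [X in y + X]addrC addrA.
under eq_bigr do rewrite progressionE.
rewrite {1}bE sum_periodic ?sum_affine_modn// => t.
by rewrite mulnDr addnA addnC modnMDl.
Qed.

Lemma sum_dirichlet_progression_le l b d x :
  (1 < l)%N -> (0 < d)%N -> (d * l.-1 < b)%N -> 0 <= x ->
  \sum_(0 <= t < b) dirichlet l (d%:R * (x + t%:R / b%:R)) <=
    b%:R * (4 + ln (2 * l%:R)).
Proof.
move=> l_gt1 d_gt0 dl_lt_b x_ge0.
have b_gt0 : (0 < b)%N := leq_ltn_trans (leq0n _) dl_lt_b.
have g_gt0 : (0 < gcdn d b)%N by rewrite gcdn_gt0 d_gt0.
have [y y_itv ->] :=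
  @sum_periodic_progression (dirichlet l) _ d _ (dirichletDn l) b_gt0 x_ge0.
have bE : (b %/ gcdn d b * gcdn d b = b)%N by rewrite divnK// dvdn_gcdr.
have gd : (gcdn d b <= d)%N by rewrite dvdn_leq// dvdn_gcdl.
have l_le : (l <= b %/ gcdn d b)%N by nia.
rewrite -[leLHS]mulr_natr -[X in _ <= X%:R * _]bE natrM mulrAC.
by rewrite ler_pM2r ?ltr0n// sum_dirichlet_grid_le// l_gt1.
Qed.

Lemma sum_prod_dirichlet_le l b d n :
  (1 < l)%N -> (0 < d)%N -> (d * l.-1 < b)%N ->
  \sum_(0 <= k < b ^ n)
      \prod_(i < n) (dirichlet l (d%:R * (k%:R / b%:R ^+ i.+1)) / l%:R : R)
    <= (b%:R * (4 + ln (2 * l%:R)) / l%:R) ^+ n.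
Proof.
move=> l_gt1 d_gt0 dl_lt_b.
have b_gt0 : (0 < b)%N := leq_ltn_trans (leq0n _) dl_lt_b.
have bX_neq0 i : b%:R ^+ i != 0 :> R by rewrite expf_neq0// pnatr_eq0 -lt0n.
apply: (sum_prod_digits_le
  (f := fun i k => dirichlet l (d%:R * (k%:R / b%:R ^+ i.+1)) / l%:R)).
- by move=> i k; rewrite divr_ge0// dirichlet_ge0.
- move=> i m k t im.
  rewrite -[in RHS](dirichletDn _ _ (d * (b ^ (m - i.+1) * t))).
  congr (dirichlet _ _ / _); rewrite natrM -mulrDr natrD mulrDl.
  rewrite -[in LHS](subnKC im) expnD -mulnA [(b ^ i.+1 * _)%N]mulnC natrM natrX.
  by rewrite mulfK.
- move=> m k; rewrite -mulr_suml ler_wpM2r ?invr_ge0//.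
  have k_ge0 : 0 <= k%:R / b%:R ^+ m.+1 :> R by rewrite divr_ge0 ?exprn_ge0.
  apply: le_trans (sum_dirichlet_progression_le l_gt1 d_gt0 dl_lt_b k_ge0).
  rewrite le_eqVlt; apply/predU1l/eq_bigr => t _.
  congr (dirichlet _ (_ * _)); rewrite natrD mulrDl natrM natrX exprSr.
  by field; rewrite bX_neq0 (bX_neq0 1%N).
Qed.

End dirichlet_progression.

Section bounded_functions.
Context d (T : measurableType d) (R : realType).
Variable mu : {finite_measure set T -> \bar R}.
Implicit Types (A : set T) (f : T -> R) (M : R).

Lemma bounded_integrable A f M : measurable A -> measurable_fun setT f ->
  (forall x, `|f x| <= M) -> mu.-integrable A (EFin \o f).
Proof.
move=> mA mf f_le; apply: measurable_bounded_integrable => //.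
- by rewrite -ge0_fin_numE ?fin_num_measure.
- exact: measurable_funTS.
- exists M; split; first exact: num_real.
  by move=> y /ltW My x _; exact: le_trans My.
Qed.

Lemma integrable_comp_continuous A (g : R -> R) f M : measurable A ->
  continuous g -> (forall x, `|g x| <= M) -> measurable_fun setT f ->
  mu.-integrable A (EFin \o (fun x => g (f x))).
Proof.
move=> mA cg g_le mf; apply: (@bounded_integrable _ _ M) => //.
exact: measurableT_comp (continuous_measurable_fun cg) mf.
Qed.

Lemma bounded_cvg_Rintegral A (f_ : (T -> R)^nat) f M : measurable A ->
  (forall n, measurable_fun setT (f_ n)) -> measurable_fun setT f ->
  {ae mu, forall x, f_ ^~ x @ \oo --> f x} -> (forall n x, `|f_ n x| <= M) ->
  \int[mu]_(x in A) f_ n x @[n --> \oo] --> \int[mu]_(x in A) f x.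
Proof.
move=> mA mf_ mf f_cvg f_le.
have [] := @dominated_convergence _ _ _ mu A mA
  (fun n => EFin \o f_ n) (EFin \o f) (cst M%:E).
- by move=> n; apply/measurable_EFinP/measurable_funTS.
- exact/measurable_EFinP/measurable_funTS.
- apply: filterS f_cvg => x f_x _; apply/fine_cvgP.
  by split; first exact: nearW.
- exact: finite_measure_integrable_cst.
- by apply: aeW => x n _; rewrite lee_fin.
move=> f_int _ int_cvg; apply: fine_cvg.
by rewrite fineK//; exact: integrable_fin_num.
Qed.

End bounded_functions.

Section integral_of_sums.
Context d (T : measurableType d) (R : realType).
Variables (mu : {measure set T -> \bar R}) (A : set T) (mA : measurable A).
Variables (I : Type) (s : seq I) (F : I -> T -> R).
Hypothesis F_int : forall i, mu.-integrable A (EFin \o F i).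

Lemma integrable_sum_EFin :
  mu.-integrable A (EFin \o (fun x => \sum_(i <- s) F i x)).
Proof.
rewrite (_ : _ \o _ = fun x => (\sum_(i <- s) (F i x)%:E)%E).
  by apply: integrable_sum => // i _; exact: F_int.
by apply/funext => x /=; rewrite sumEFin.
Qed.

Lemma Rintegral_sum :
  \int[mu]_(x in A) (\sum_(i <- s) F i x) =
    \sum_(i <- s) \int[mu]_(x in A) F i x.
Proof.
rewrite /Rintegral; under eq_integral do rewrite -sumEFin.
rewrite integral_sum// -EFin_sum_fine// => i _.
exact: integrable_fin_num (F_int i).
Qed.

End integral_of_sums.

Section almost_everywhere_full.
Context d (T : measurableType d) (R : realType).
Implicit Types (A : set T) (f : T -> R).

Lemma Rintegral_ae_full (mu : {measure set T -> \bar R}) A f :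
  measurable A -> measurable_fun setT f -> {ae mu, forall x, A x} ->
  \int[mu]_(x in A) f x = \int[mu]_x f x.
Proof.
move=> mA mf A_ae; rewrite Rintegral_mkcond; congr fine.
apply: ae_eq_integral => //; last 2 first.
- exact/measurable_EFinP.
- by apply: filterS A_ae => x Ax _; rewrite /= patchE mem_set.
by apply/measurable_EFinP/(measurable_restrictT _ mA).1/measurable_funTS.
Qed.

Lemma measure_ae_full (mu : {measure set T -> \bar R}) A :
  measurable A -> {ae mu, forall x, A x} -> mu A = mu setT.
Proof.
move=> mA A_ae; have mCA := measurableC mA.
have muCA : mu (~` A) = 0%E by apply/(negligibleP mu mCA).
rewrite [RHS](measureDI _ measurableT mA) setTD setTI.
by rewrite [X in (X + _)%E]muCA add0e.
Qed.

Lemma ae_distribution (P : probability T R) (X : {RV P >-> R}) (B : set R) :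
  measurable B -> {ae P, forall t, B (X t)} ->
  {ae distribution P X, forall x, B x}.
Proof.
move=> mB BX_ae; have mXB : measurable (X @^-1` ~` B).
  rewrite -[X in measurable X]setTI.
  by apply: measurable_funPT => //; exact: measurableC.
apply/(negligibleP (distribution P X)); first exact: measurableC.
exact/(negligibleP P mXB).
Qed.

End almost_everywhere_full.

Section random_digits.
Context {R : realType} {disp : measure_display} {T : measurableType disp}.
Variables (P : probability T R) (D : {fset nat}) (X : nat -> {RV P >-> nat}).

Let measurable_preimage i (B : set nat) : measurable (X i @^-1` B).
Proof. by rewrite -[X in measurable X]setTI; exact: measurable_funPT. Qed.

Definition digit_event m (w : {ffun 'I_m -> D}) : set T :=
  [set t | forall i : 'I_m, X i t = val (w i)].

Let digit_eventE m (w : {ffun 'I_m -> D}) : digit_event w =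
  \bigcap_(i in [set` [fset i in iota 0 m]%fset])
    (X i @^-1` [set if insub i is Some j then val (w j) else 0%N]).
Proof.
apply/seteqP; split => [t Xt i|t Xt i]; rewrite /=.
  rewrite !inE mem_iota/= add0n => im.
  by rewrite insubT /= -(Xt (Sub i im)).
have := Xt (val i); rewrite /= !inE mem_iota/= add0n valK.
by apply; exact: ltn_ord.
Qed.

Lemma measurable_digit_event m (w : {ffun 'I_m -> D}) :
  measurable (digit_event w).
Proof. by rewrite digit_eventE; exact: bigcap_measurableType. Qed.

Hypothesis X_uniform : forall i, uniform_on D (X i).

Lemma ae_digits : {ae P, forall t, forall i, X i t \in D}.
Proof.
apply: ae_foralln => i.
apply: (@negligibleS _ _ _ _
  (\bigcup_k if k \in D then set0 else X i @^-1` [set k])).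
  by move=> t /negP/negPf Xt; exists (X i t); rewrite ?Xt.
apply: negligible_bigcup => k; case: ifPn => [_|/negPf kD].
  exact: negligible_set0.
apply/(negligibleP P (measurable_preimage i _)).
by have := X_uniform i k; rewrite kD.
Qed.

Hypothesis X_indep : mutually_independent X.

Lemma probability_digit_event m (w : {ffun 'I_m -> D}) :
  P (digit_event w) = (#|` D|%fset%:R ^- m)%:E.
Proof.
rewrite digit_eventE X_indep (perm_big (iota 0 m)); last first.
  by apply: uniq_perm; rewrite ?iota_uniq ?fset_uniq// => i; rewrite !inE.
rewrite -{1}[m]subn0 -/(index_iota 0 m) big_mkord.
under eq_bigr do rewrite valK X_uniform fsvalP.
by rewrite prodEFin prodr_const card_ord exprVn.
Qed.

Lemma Rintegral_digit_event m (h : T -> R) (g : {ffun 'I_m -> D} -> R) :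
  measurable_fun setT h -> (forall w t, digit_event w t -> h t = g w) ->
  \int[P]_t h t = \sum_(w : {ffun 'I_m -> D}) #|` D|%fset%:R ^- m * g w.
Proof.
move=> mh h_event.
have ind_int (w : {ffun 'I_m -> D}) :
    P.-integrable setT (EFin \o (\1_(digit_event w) : T -> R)).
  by apply: integrable_indic; exact: measurable_digit_event.
have term_int (w : {ffun 'I_m -> D}) :
    P.-integrable setT (EFin \o (fun t => g w * \1_(digit_event w) t)).
  by have := integrableZl measurableT (g w) (ind_int w).
transitivity (\int[P]_t \sum_w g w * \1_(digit_event w) t).
  congr fine; apply: ae_eq_integral => //; first exact/measurable_EFinP.
    apply/measurable_EFinP/measurable_sum => w.
    by apply/measurable_EFinP; exact: measurable_int (term_int w).
  apply: filterS ae_digits => t Xt _; congr EFin.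
  pose w0 : {ffun 'I_m -> D} := [ffun i : 'I_m => FSetSub (Xt i)].
  have w0_event : digit_event w0 t by move=> i; rewrite ffunE.
  rewrite (h_event _ _ w0_event) (bigD1 w0)//= indicE mem_set// mulr1.
  rewrite big1 ?addr0// => w /eqP w_neq; rewrite indicE memNset ?mulr0// => wt.
  by apply: w_neq; apply/ffunP => i; apply: val_inj; rewrite ffunE/= wt.
rewrite Rintegral_sum//; apply: eq_bigr => w _.
have -> : #|` D|%fset%:R ^- m = fine (P (digit_event w)).
  by rewrite probability_digit_event.
rewrite RintegralZl// mulrC /Rintegral integral_indic// ?setIT//.
exact: measurable_digit_event.
Qed.

End random_digits.

Section characteristic_function.
Context {R : realType} {disp : measure_display} {T : measurableType disp}.
Variable P : probability T R.
Implicit Types (Z : T -> R) (y : R).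

Definition characteristic Z y : R[i] :=
  let f t := cexp2pi (- (y * Z t)) in
  ((\int[P]_t complex.Re (f t)) +i* (\int[P]_t complex.Im (f t)))%C.

Lemma cvg_normc_characteristic (Z_ : (T -> R)^nat) Z y :
  (forall n, measurable_fun setT (Z_ n)) -> measurable_fun setT Z ->
  {ae P, forall t, Z_ ^~ t @ \oo --> Z t} ->
  normc (characteristic (Z_ n) y) @[n --> \oo] --> normc (characteristic Z y).
Proof.
move=> mZ_ mZ Z_cvg.
have component (g : R -> R) : continuous g -> (forall x, `|g x| <= 1) ->
    \int[P]_t g (- (y * Z_ n t)) @[n --> \oo] --> \int[P]_t g (- (y * Z t)).
  move=> cg g_le; have mg := continuous_measurable_fun cg.
  apply: bounded_cvg_Rintegral (fun=> _) _ _ _ => //.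
  - move=> n; apply: (measurableT_comp mg).
    by apply: measurableT_comp => //; exact: measurable_funM.
  - apply: (measurableT_comp mg).
    by apply: measurableT_comp => //; exact: measurable_funM.
  - apply: filterS Z_cvg => t Zt; apply: (continuous_cvg _ (cg _)).
    by apply: cvgN; apply: cvgMr.
rewrite /characteristic /=; apply: (continuous_cvg _ (@sqrt_continuous R _)).
apply: cvgD; apply: (continuous_cvg _ (@exprn_continuous _ _ _)).
- exact: (component _ continuous_Re_cexp2pi norm_Re_cexp2pi_le1).
- exact: (component _ continuous_Im_cexp2pi norm_Im_cexp2pi_le1).
Qed.

End characteristic_function.

Lemma cvg_digit_sum (R : realType) b (u : nat -> nat) :
  (1 < b)%N -> (forall i, u i < b)%N ->
  \sum_(i < m) (u i)%:R / b%:R ^+ i.+1 @[m --> \oo] --> (digit_sum b u : R).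
Proof.
move=> b_gt1 u_lt; have b_gt0 : 0 < b%:R :> R by rewrite ltr0n ltnW.
have bV_lt1 : `|b%:R^-1| < 1 :> R.
  by rewrite gtr0_norm ?invr_gt0// invf_lt1// ltr1n.
have lower_cvg : digit_sum b u - b%:R^-1 ^+ m @[m --> \oo] -->
    (digit_sum b u : R).
  rewrite -[X in _ --> X]subr0.
  by apply: cvgB; [exact: cvg_cst|exact: cvg_expr bV_lt1].
apply: squeeze_cvgr lower_cvg (cvg_cst _).
near=> m; have /andP[] := @digit_sum_bounds R b b_gt1 u m u_lt.
by rewrite big_mkord exprVn lerBlDr => -> ->.
Unshelve. all: by end_near. Qed.

Section missing_digit_fourier.
Context {R : realType} {disp : measure_display} {T : measurableType disp}.
Variables (P : probability T R) (b : nat) (D : {fset nat}).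
Variable X : nat -> {RV P >-> nat}.
Hypotheses (b_gt1 : (1 < b)%N) (D_lt : [set` D] `<=` `I_b).
Hypothesis X_uniform : forall i, uniform_on D (X i).

Lemma ae_random_digit_sum :
  {ae P, forall t, missing_digit_set b D (random_digit_sum b X t : R)}.
Proof.
apply: filterS (ae_digits X_uniform) => t Xt; split; last by exists (X ^~ t).
by apply: digit_sum_itv => // i; exact: D_lt (Xt i).
Qed.

Lemma measurable_missing_digit_set : measurable (missing_digit_set b D : set R).
Proof.
apply: closed_measurable; apply: compact_closed; first exact: Rhausdorff.
exact: compact_missing_digit_set.
Qed.

Lemma ae_missing_digit_measure :
  {ae missing_digit_measure b X, forall x, missing_digit_set b D x}.
Proof.
apply: ae_distribution ae_random_digit_sum.
exact: measurable_missing_digit_set.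
Qed.

Lemma fourier_missing_digit_measure (xi : int) :
  fourier (missing_digit_measure b X) xi =
    characteristic P (random_digit_sum b X) xi%:~R.
Proof.
have unit_ae : {ae missing_digit_measure b X, forall x, `[0, 1]%classic x}.
  by apply: filterS ae_missing_digit_measure => x [].
have component (g : R -> R) : continuous g -> (forall x, `|g x| <= 1) ->
    \int[missing_digit_measure b X]_(x in `[0, 1]) g (- (xi%:~R * x)) =
    \int[P]_t g (- (xi%:~R * random_digit_sum b X t)).
  move=> cg g_le; pose h x : R := g (- (xi%:~R * x)).
  have mh : measurable_fun setT h.
    apply: measurableT_comp; first exact: continuous_measurable_fun.
    by apply: measurableT_comp => //; exact: measurable_funM.
  rewrite (Rintegral_ae_full _ mh)//; congr fine.
  rewrite (integral_distribution (X := random_digit_sum b X))//.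
    exact/measurable_EFinP.
  apply: integrable_comp_continuous cg g_le _ => //.
  by apply: measurableT_comp => //; exact: measurable_funM.
rewrite /fourier /characteristic; congr (_ +i* _)%C.
- exact: (component _ continuous_Re_cexp2pi norm_Re_cexp2pi_le1).
- exact: (component _ continuous_Im_cexp2pi norm_Im_cexp2pi_le1).
Qed.

Definition partial_digit_sum m t : R := \sum_(i < m) (X i t)%:R / b%:R ^+ i.+1.

Lemma measurable_partial_digit_sum m :
  measurable_fun setT (partial_digit_sum m).
Proof.
apply: measurable_sum => i.
rewrite (_ : (fun _ => _) = (fun n : nat => n%:R / b%:R ^+ i.+1 : R) \o X i)//.
exact: measurableT_comp.
Qed.

Lemma ae_cvg_partial_digit_sum : {ae P, forall t,
  partial_digit_sum ^~ t @ \oo --> (random_digit_sum b X t : R)}.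
Proof.
apply: filterS (ae_digits X_uniform) => t Xt.
by apply: (cvg_digit_sum b_gt1 (u := X ^~ t)) => i; exact: D_lt (Xt i).
Qed.

(* Modulus of the characteristic function of a uniform digit at [x]. *)
Definition digit_transform x : R :=
  normc (\sum_(k : D) cexp2pi (- (x * (val k)%:R))) / #|` D|%fset%:R.

Lemma digit_transform_ge0 x : 0 <= digit_transform x.
Proof. by rewrite divr_ge0 ?normc_ge0. Qed.

Lemma digit_transform_le1 x : digit_transform x <= 1.
Proof.
have [D_eq0|D_neq0] := eqVneq (#|` D|)%fset 0%N.
  by rewrite /digit_transform D_eq0 invr0 mulr0 ler01.
rewrite ler_pdivrMr ?ltr0n ?lt0n// mul1r (le_trans (normc_sum _ _ _))//.
under eq_bigr do rewrite normc_cexp2pi.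
by rewrite sumr_const -cardfE.
Qed.

Hypothesis X_indep : mutually_independent X.

Lemma normc_characteristic_partial_digit_sum m y :
  normc (characteristic P (partial_digit_sum m) y) =
    \prod_(i < m) digit_transform (y / b%:R ^+ i.+1).
Proof.
pose s (w : {ffun 'I_m -> D}) : R :=
  \sum_(i < m) (val (w i))%:R / b%:R ^+ i.+1.
have component (g : R -> R) : continuous g ->
    \int[P]_t g (- (y * partial_digit_sum m t)) =
    \sum_(w : {ffun 'I_m -> D}) #|` D|%fset%:R ^- m * g (- (y * s w)).
  move=> cg; apply: Rintegral_digit_event => //.
    apply: measurableT_comp; first exact: continuous_measurable_fun.
    apply: measurableT_comp => //; apply: measurable_funM => //.
    exact: measurable_partial_digit_sum.
  by move=> w t wt; congr (g (- (y * _))); apply: eq_bigr => i _; rewrite wt.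
have -> : characteristic P (partial_digit_sum m) y =
    (#|` D|%fset%:R ^- m)%:C%C * \sum_w cexp2pi (- (y * s w)).
  apply/eqP; rewrite mulr_sumr eq_complex !raddf_sum.
  apply/andP; split; apply/eqP.
  - rewrite [LHS](component _ continuous_Re_cexp2pi).
    by apply: eq_bigr => w _; rewrite /= mul0r subr0.
  - rewrite [LHS](component _ continuous_Im_cexp2pi).
    by apply: eq_bigr => w _; rewrite /= mul0r addr0.
have -> : \sum_w cexp2pi (- (y * s w)) =
    \prod_(i < m) \sum_(k : D)
      cexp2pi (- (y / b%:R ^+ i.+1 * (val k)%:R)) :> R[i].
  rewrite bigA_distr_bigA/=; apply: eq_bigr => w _.
  rewrite -cexp2pi_sum sumrN mulr_sumr; congr (cexp2pi (- _)).
  by apply: eq_bigr => i _; rewrite mulrCA mulrC.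
rewrite normcM normc_real_complex normc_prod big_split/= prodr_const card_ord.
by rewrite mulrC ger0_norm ?invr_ge0 ?exprn_ge0// exprVn.
Qed.

Lemma normc_fourier_le (xi : int) n :
  normc (fourier (missing_digit_measure b X) xi) <=
    \prod_(i < n) digit_transform (xi%:~R / b%:R ^+ i.+1).
Proof.
rewrite fourier_missing_digit_measure.
have cvg_char := @cvg_normc_characteristic _ _ _ P _ _ xi%:~R
  measurable_partial_digit_sum (measurable_random_digit_sum b X)
  ae_cvg_partial_digit_sum.
rewrite -(cvg_lim _ cvg_char)//; apply: limr_le; first exact: cvgP cvg_char.
exists n => // m nm; rewrite [leLHS]normc_characteristic_partial_digit_sum.
rewrite -(subnKC nm) big_split_ord/= ler_piMr//.
  by apply: prodr_ge0 => i _; exact: digit_transform_ge0.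
by apply: prodr_ile1 => i _; rewrite digit_transform_ge0 digit_transform_le1.
Qed.

End missing_digit_fourier.

Lemma cvg_mulr_powR0 (R : realType) (C s : R) : 0 < s ->
  C * r `^ s @[r --> 0^'+] --> 0.
Proof.
move=> s_gt0; rewrite -[X in _ --> X](mulr0 C).
by apply: cvgMr; exact: powR_cvg0.
Qed.

Section hausdorff_measure_theory.
Context {R : realType}.
Implicit Types (A : set R) (s e delta C : R).

Lemma dist_le_diam A x y : A x -> A y -> (`|x - y|%:E <= diam A)%E.
Proof. by move=> Ax Ay; apply: ereal_sup_ubound; exists (x, y). Qed.

Lemma diam_ge0 A : A !=set0 -> (0 <= diam A)%E.
Proof.
by move=> [x Ax]; rewrite (le_trans _ (dist_le_diam Ax Ax))// lee_fin.
Qed.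

Lemma diam_set0 : diam (set0 : set R) = -oo%E.
Proof. by rewrite /diam setX0 image_set0 ereal_sup0. Qed.

Lemma diam_pow_ge0 s A : (0 <= diam_pow s A)%E.
Proof. by rewrite /diam_pow; case: ifPn => // _; exact: poweR_ge0. Qed.

Lemma diam_pow_le s e A : 0 <= s -> 0 <= e ->
  (diam A <= e%:E)%E -> (diam_pow s A <= (e `^ s)%:E)%E.
Proof.
move=> s_ge0 e_ge0 Ae; rewrite /diam_pow.
case: ifPn => [_|/set0P/diam_ge0 A_ge0].
  by rewrite lee_fin powR_ge0.
by rewrite -poweR_EFin gt0_ler_poweR// in_itv/= ?A_ge0 ?lee_fin ?e_ge0 leey.
Qed.

Lemma hausdorff_premeasure_ge0 s delta A :
  (0 <= hausdorff_premeasure s delta A)%E.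
Proof.
apply: le_ereal_inf_tmp => _ [U _ <-]; apply: nneseries_ge0 => i _ _.
exact: diam_pow_ge0.
Qed.

Lemma hausdorff_premeasure_le_measure s delta A : 0 < delta ->
  (hausdorff_premeasure s delta A <= hausdorff_measure s A)%E.
Proof. by move=> delta_gt0; apply: ereal_sup_ubound; exists delta. Qed.

Lemma hausdorff_premeasure_le_cover (I : finType) (U : I -> set R) s delta e A :
  0 <= s -> 0 <= e <= delta -> A `<=` \bigcup_i U i ->
  (forall i, (diam (U i) <= e%:E)%E) ->
  (hausdorff_premeasure s delta A <= (#|I|%:R * e `^ s)%:E)%E.
Proof.
move=> s_ge0 /andP[e_ge0 e_le] AU U_diam.
pose V (i : nat) : set R :=
  if insub i is Some j then U (enum_val (j : 'I_#|I|)) else set0.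
have V_diam i : (diam (V i) <= e%:E)%E.
  by rewrite /V; case: insub => [j|] //; rewrite diam_set0 leNye.
apply: ge_ereal_inf; exists (\sum_(0 <= i <oo) diam_pow s (V i))%E.
  exists V => //; split=> [x /AU[i _ Ux]|i].
    by exists (val (enum_rank i)) => //; rewrite /V valK enum_rankK.
  by rewrite (le_trans (V_diam i))// lee_fin.
rewrite (nneseries_split 0 #|I|); last by move=> i _; exact: diam_pow_ge0.
rewrite eseries0 ?adde0; last first.
  move=> i /= iI _; rewrite /V insubN -?leqNgt//.
  by rewrite /diam_pow eqxx.
rewrite add0n.
apply: (le_trans (lee_sum _ (fun i _ => diam_pow_le s_ge0 e_ge0 (V_diam i)))).
by rewrite sumEFin sumr_const_nat subn0 mulr_natl.
Qed.

Lemma hausdorff_dim_le_covers s C A : 0 <= s ->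
  (forall delta, 0 < delta -> exists (I : finType) (U : I -> set R) (e : R),
    [/\ 0 < e <= delta, A `<=` \bigcup_i U i,
      forall i, (diam (U i) <= e%:E)%E & #|I|%:R * e `^ s <= C]) ->
  (hausdorff_dim A <= s%:E)%E.
Proof.
move=> s_ge0 covers; apply/lee_addgt0Pr => h h_gt0; rewrite -EFinD.
have sh_ge0 : 0 <= s + h by rewrite addr_ge0// ltW.
apply: ereal_inf_lbound; exists (s + h) => //; split => //.
apply/eqP; rewrite eq_le; apply/andP; split; last first.
  apply: le_trans (hausdorff_premeasure_le_measure _ _ ltr01).
  exact: hausdorff_premeasure_ge0.
apply: ge_ereal_sup => _ [delta /= delta_gt0 <-].
apply/lee_addgt0Pr => eps eps_gt0; rewrite add0e.
have C_cvg := cvg_mulr_powR0 C h_gt0.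
near (0 : R)^'+ => r.
have r_gt0 : 0 < r by near: r; exact: nbhs_right_gt.
have r_le : r <= delta by near: r; exact: nbhs_right_le.
have Cr_le : C * r `^ h <= eps by near: r; exact: (cvgr_le 0).
have [I [U [e [/andP[e_gt0 e_le] AU U_diam card_le]]]] := covers r r_gt0.
apply: (le_trans (hausdorff_premeasure_le_cover sh_ge0 _ AU U_diam)).
  by rewrite ltW//= (le_trans e_le).
have C_ge0 : 0 <= C by apply: le_trans card_le; rewrite mulr_ge0 ?powR_ge0.
rewrite lee_fin (le_trans _ Cr_le)// powRD ?(gt_eqF e_gt0) ?implybT// mulrA.
rewrite ler_pM ?mulr_ge0 ?powR_ge0//.
by apply: ge0_ler_powR; rewrite ?nnegrE ?(ltW h_gt0) ?(ltW e_gt0) ?(ltW r_gt0).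
Unshelve. all: by end_near. Qed.

End hausdorff_measure_theory.

Section frostman.
Context {R : realType}.
Variable mu : {measure set R -> \bar R}.
Implicit Types (A U V : set R) (s t r c C delta : R).

Definition frostman s C delta := forall c r, 0 < r <= delta ->
  (mu `[(c - r)%R, (c + r)%R]%classic <= (C * r `^ s)%:E)%E.

Lemma frostmanW s t C delta : t <= s -> 0 <= C ->
  frostman s C delta -> frostman t C (Num.min delta 1).
Proof.
move=> ts C_ge0 mu_frostman c r; rewrite le_min => /and3P[r_gt0 r_le r_le1].
apply: le_trans (mu_frostman c r _) _; first by rewrite r_gt0.
by rewrite lee_fin ler_wpM2l// ger_powR// r_gt0.
Qed.

Lemma frostman_itv_le s C delta c r : 0 <= s -> 0 < delta ->
  frostman s C delta -> 0 <= r <= delta ->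
  (mu `[(c - r)%R, (c + r)%R]%classic <= (C * r `^ s)%:E)%E.
Proof.
move=> s_ge0 delta_gt0 mu_frostman /andP[].
rewrite le_eqVlt => /predU1P[<- _|r_gt0 r_le]; last first.
  by apply: mu_frostman; rewrite r_gt0.
have ball0_le r' : 0 < r' <= delta ->
    (mu `[(c - 0)%R, (c + 0)%R]%classic <= (C * r' `^ s)%:E)%E.
  move=> /[dup] /andP[r'_gt0 _] /(mu_frostman c); apply: le_trans.
  apply: le_measure; rewrite ?inE//.
  by apply: subset_itv; rewrite bnd_simp ?lerD2l ?lerN2 ltW.
move: s_ge0; rewrite le_eqVlt => /predU1P[s_eq0|s_gt0].
  by have := ball0_le delta; rewrite -s_eq0 !powRr0 delta_gt0 lexx; apply.
rewrite powR0 ?gt_eqF// mulr0; apply/lee_addgt0Pr => eps eps_gt0; rewrite add0e.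
have C_cvg := cvg_mulr_powR0 C s_gt0.
near (0 : R)^'+ => r'; apply: (@le_trans _ _ (C * r' `^ s)%:E).
  apply: ball0_le; apply/andP; split.
    by near: r'; exact: nbhs_right_gt.
  by near: r'; exact: nbhs_right_le.
by rewrite lee_fin; near: r'; exact: (cvgr_le 0).
Unshelve. all: by end_near. Qed.

Lemma frostman_le_diam_pow s C delta U : 0 <= s -> 0 < delta ->
  frostman s C delta -> (diam U <= delta%:E)%E ->
  exists V, [/\ measurable V, U `<=` V & (mu V <= C%:E * diam_pow s U)%E].
Proof.
move=> s_ge0 delta_gt0 mu_frostman U_le; rewrite /diam_pow.
case: ifPn => [/eqP ->|/set0P U_neq0].
  by exists set0; split => //; rewrite measure0 mule0.
have diam_fin : diam U \is a fin_num.
  by rewrite ge0_fin_numE ?diam_ge0// (le_lt_trans U_le)// ltry.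
have [c Uc] := U_neq0.
exists `[c - fine (diam U), c + fine (diam U)]%classic; split => //.
  move=> x Ux; rewrite /= in_itv/= -ler_distl -lee_fin fineK//.
  exact: dist_le_diam.
rewrite -[in leRHS](fineK diam_fin) poweR_EFin -EFinM.
apply: frostman_itv_le mu_frostman _ => //.
by rewrite -!lee_fin fineK// diam_ge0.
Qed.

Lemma frostman_le_premeasure s C delta A : 0 <= s -> 0 < C -> 0 < delta ->
  frostman s C delta -> measurable A ->
  (mu A <= C%:E * hausdorff_premeasure s delta A)%E.
Proof.
move=> s_ge0 C_gt0 delta_gt0 mu_frostman mA; rewrite -lee_pdivrMl//.
apply: le_ereal_inf_tmp => _ [U [AU U_le] <-].
have [V UV] := choice (fun i =>
  frostman_le_diam_pow s_ge0 delta_gt0 mu_frostman (U_le i)).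
rewrite lee_pdivrMl// -nneseriesZl; last by move=> i _; exact: diam_pow_ge0.
apply: (@le_trans _ _ (\sum_(0 <= i <oo) mu (V i))%E).
  apply: measure_sigma_subadditive => //; first by move=> i; have [] := UV i.
  by move=> x /AU[i _ Ux]; exists i => //; have [_ + _] := UV i; exact.
by apply: lee_nneseries => // i _; have [] := UV i.
Qed.

Lemma mass_distribution_principle s C delta A : 0 < C -> 0 < delta ->
  frostman s C delta -> measurable A -> (0 < mu A)%E ->
  (s%:E <= hausdorff_dim A)%E.
Proof.
move=> C_gt0 delta_gt0 mu_frostman mA muA_gt0.
apply: le_ereal_inf_tmp => _ [t [t_ge0 Ht_eq0] <-].
rewrite lee_fin leNgt; apply/negP => /ltW ts.
have min_gt0 : 0 < Num.min delta 1 by rewrite lt_min delta_gt0 ltr01.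
have := frostman_le_premeasure t_ge0 C_gt0 min_gt0
  (frostmanW ts (ltW C_gt0) mu_frostman) mA.
rewrite leNgt => /negP; apply; apply: le_lt_trans muA_gt0.
rewrite -(mule0 C%:E) -Ht_eq0 lee_wpmul2l ?lee_fin ?(ltW C_gt0)//.
exact: hausdorff_premeasure_le_measure.
Qed.

End frostman.

Lemma sum_dist_le (R : realDomainType) (a : nat -> R) N j :
  (forall n, 0 <= a n) -> (j < N)%N ->
  \sum_(0 <= k < N) a `|j - k|%N <= 2 * \sum_(0 <= k < N) a k.
Proof.
move=> a_ge0 jN; rewrite (@big_cat_nat _ _ _ j)//=; last exact: ltnW.
have sub_le m n : (m <= n <= N)%N ->
    \sum_(m <= k < n) a k <= \sum_(0 <= k < N) a k.
  move=> /andP[mn nN].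
  rewrite (@big_cat_nat _ _ _ n 0 N)//= (@big_cat_nat _ _ _ m 0 n)//=.
  by rewrite [X in _ <= X + _]addrC -addrA lerDl addr_ge0// sumr_ge0.
rewrite mulr_natl mulr2n lerD//.
  rewrite big_nat_rev/= add0n (eq_big_nat _ _ (F2 := fun k => a k.+1)).
    by rewrite -(big_add1 _ _ 0 j.+1 xpredT) sub_le.
  by move=> k kj; congr a; lia.
rewrite -{1}[j]add0n big_addn (eq_big_nat _ _ (F2 := a)).
  by rewrite sub_le// leq_subr.
by move=> k kj; congr a; lia.
Qed.

Section fourier_of_measure.
Context {R : realType}.
Variable nu : {finite_measure set R -> \bar R}.
Implicit Types (A : set R) (s c r C : R) (n N k : nat).

Lemma integrable_Re_cexp2pi A (h : R -> R) : measurable A ->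
  measurable_fun setT h ->
  nu.-integrable A (EFin \o (fun x => complex.Re (cexp2pi (h x)))).
Proof.
move=> mA mh.
exact: integrable_comp_continuous continuous_Re_cexp2pi norm_Re_cexp2pi_le1 mh.
Qed.

Lemma integrable_Im_cexp2pi A (h : R -> R) : measurable A ->
  measurable_fun setT h ->
  nu.-integrable A (EFin \o (fun x => complex.Im (cexp2pi (h x)))).
Proof.
move=> mA mh.
exact: integrable_comp_continuous continuous_Im_cexp2pi norm_Im_cexp2pi_le1 mh.
Qed.

Let measurable_affine (a c : R) :
  measurable_fun setT (fun x : R => a * (x - c)).
Proof. by apply: measurable_funM => //; exact: measurable_funB. Qed.

Let measurable_phase (xi : int) :
  measurable_fun setT (fun x : R => - (xi%:~R * x)).
Proof. by apply: measurableT_comp => //; exact: measurable_funM. Qed.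

Lemma normc_fourier0 : normc (fourier nu 0) = fine (nu `[0, 1]%classic).
Proof.
have int_cst (g : R -> R) : \int[nu]_(x in `[0, 1]) g (- (0%:~R * x)) =
    g 0 * fine (nu `[0, 1]%classic).
  rewrite -Rintegral_cst//; apply: eq_Rintegral => x _.
  by rewrite mul0r oppr0.
rewrite /fourier (int_cst (fun x => complex.Re (cexp2pi x))).
rewrite (int_cst (fun x => complex.Im (cexp2pi x))) cexp2pi0 mul1r mul0r.
by rewrite normc_real_complex ger0_norm// fine_ge0.
Qed.

Lemma normc_fourier_le_mass n :
  normc (fourier nu n) <= 2 * fine (nu `[0, 1]%classic).
Proof.
have component (g : R -> R) : (forall x, `|g x| <= 1) ->
    nu.-integrable `[0, 1] (EFin \o g) ->
    `|\int[nu]_(x in `[0, 1]) g x| <= fine (nu `[0, 1]%classic).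
  move=> g_le g_int; apply: le_trans (le_normr_Rintegral _ g_int) _ => //.
  rewrite -[leRHS]mul1r -Rintegral_cst//; apply: le_Rintegral => //.
    exact: integrable_norm g_int.
  exact: finite_measure_integrable_cst.
apply: le_trans (normc_le_Re_Im _) _; rewrite mulr_natl mulr2n; apply: lerD.
- apply: component => [x|]; first exact: norm_Re_cexp2pi_le1.
  exact: integrable_Re_cexp2pi (measurable_phase n).
- apply: component => [x|]; first exact: norm_Im_cexp2pi_le1.
  exact: integrable_Im_cexp2pi (measurable_phase n).
Qed.

Lemma Rintegral_Re_cexp2pi_shift n c :
  \int[nu]_(x in `[0, 1]) complex.Re (cexp2pi (n%:R * (x - c))) =
    complex.Re (cexp2pi (n%:R * c) * fourier nu n).
Proof.
have ReM (w z : R[i]) : complex.Re (w * z) =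
    complex.Re w * complex.Re z - complex.Im w * complex.Im z.
  by case: w z => [? ?] [? ?].
have m01 := @measurable_itv R `[0, 1].
have int_Re := integrable_Re_cexp2pi m01 (measurable_phase n).
have int_Im := integrable_Im_cexp2pi m01 (measurable_phase n).
rewrite ReM -[complex.Re (fourier _ _)]/(Rintegral _ _ _).
rewrite -[complex.Im (fourier _ _)]/(Rintegral _ _ _).
rewrite -!RintegralZl// -RintegralB//.
- apply: eq_Rintegral => x _; rewrite -ReM -cexp2piD -opprB mulrN cexp2piN.
  by rewrite mulrBr; case: (cexp2pi _).
- exact: integrableZl int_Re.
- exact: integrableZl int_Im.
Qed.

Lemma integrable_sqr_dirichlet_row N c (j : 'I_N) :
  nu.-integrable `[0, 1] (EFin \o
    (fun x => \sum_(k < N) complex.Re (cexp2pi (`|j - k|%N%:R * (x - c))))).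
Proof.
apply: integrable_sum_EFin => // k.
exact: integrable_Re_cexp2pi (measurable_affine _ _).
Qed.

Lemma integrable_sqr_dirichlet N c :
  nu.-integrable `[0, 1] (EFin \o (fun x => dirichlet N (x - c) ^+ 2)).
Proof.
under [X in EFin \o X]eq_fun do rewrite sqr_dirichlet.
by apply: integrable_sum_EFin => // j; exact: integrable_sqr_dirichlet_row.
Qed.

Lemma Rintegral_sqr_dirichlet_le N c :
  \int[nu]_(x in `[0, 1]) dirichlet N (x - c) ^+ 2 <=
    N%:R * (2 * \sum_(0 <= k < N) normc (fourier nu k)).
Proof.
under eq_Rintegral do rewrite sqr_dirichlet.
have row_int := @integrable_sqr_dirichlet_row N c.
have term_int (j k : 'I_N) := integrable_Re_cexp2pi (measurable_itv `[0, 1])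
  (measurable_affine `|j - k|%N%:R c).
rewrite Rintegral_sum//.
pose modulus k := normc (fourier nu k%:Z).
have modulus_ge0 k : 0 <= modulus k by exact: normc_ge0.
apply: (@le_trans _ _ (\sum_(j < N) 2 * \sum_(0 <= k < N) modulus k));
  last by rewrite sumr_const card_ord [leRHS]mulr_natl.
apply: ler_sum => j _; rewrite Rintegral_sum//.
apply: le_trans (sum_dist_le modulus_ge0 (ltn_ord j)).
rewrite big_mkord; apply: ler_sum => k _; rewrite Rintegral_Re_cexp2pi_shift.
by rewrite (le_trans (Re_le_normc _))// normcM normc_cexp2pi mul1r.
Qed.

(* Fejer's kernel [dirichlet N (x - c) ^+ 2] is nonnegative and at least
   [N ^+ 2 / 4] on the interval. *)
Lemma measure_itv_le_fourier N c r :
  {ae nu, forall x, `[0, 1]%classic x} -> (0 < N)%N -> r * N%:R <= 16^-1 ->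
  (nu `[(c - r)%R, (c + r)%R]%classic <=
    (8 / N%:R * \sum_(0 <= k < N) normc (fourier nu k))%:E)%E.
Proof.
move=> nu_unit N_gt0 rN; set I := `[c - r, c + r]%classic.
have NR_gt0 : 0 < N%:R :> R by rewrite ltr0n.
have mI : measurable I by exact: measurable_itv.
have I_int : nu.-integrable `[0, 1] (EFin \o (\1_I : R -> R)).
  by apply: (integrableS measurableT) => //; exact: integrable_indic.
have D_int := integrable_sqr_dirichlet N c.
have nuIE : fine (nu I) = \int[nu]_(x in `[0, 1]) \1_I x.
  by rewrite Rintegral_ae_full// /Rintegral integral_indic// setIT.
have lower : N%:R ^+ 2 / 4 * fine (nu I) <=
    \int[nu]_(x in `[0, 1]) dirichlet N (x - c) ^+ 2.
  rewrite nuIE -RintegralZl//; apply: le_Rintegral => //.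
    exact: integrableZl I_int.
  move=> x _; rewrite indicE; have [xI|_] := boolP (x \in I); last first.
    by rewrite mulr0 sqr_ge0.
  have -> : N%:R ^+ 2 / 4 * true%:R = (N%:R / 2) ^+ 2 :> R.
    by rewrite mulr1; field.
  rewrite ler_sqr ?nnegrE ?dirichlet_ge0 ?divr_ge0//; apply: dirichlet_ge_half.
  apply: le_trans rN; rewrite ler_wpM2r// ler_distl.
  by move: xI; rewrite /I inE/= in_itv.
rewrite -[leLHS]fineK ?fin_num_measure// lee_fin.
have := le_trans lower (Rintegral_sqr_dirichlet_le N c).
move: (fine _) (\sum_(_ <= _ < _) _) => mass S mass_le.
rewrite mulrAC ler_pdivlMr// -(@ler_pM2l _ (N%:R / 4)) ?divr_gt0//.
by move: mass_le; rewrite expr2; lra.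
Qed.

Lemma frostman_fourier s C : {ae nu, forall x, `[0, 1]%classic x} ->
  0 <= s -> 0 <= C ->
  (forall Q, (1 <= Q)%N ->
    \sum_(0 <= k < Q.+1) normc (fourier nu k) <= C * Q%:R `^ (1 - s)) ->
  frostman nu s (8 * C * 32 `^ s) 16^-1.
Proof.
move=> nu_unit s_ge0 C_ge0 sum_le c r /andP[r_gt0 r_le].
have w_ge0 : 0 <= (16 * r)^-1 by rewrite invr_ge0 mulr_ge0// ltW.
pose N := Num.truncn (16 * r)^-1.
have /andP[N_le N_gt] := truncn_itv w_ge0; rewrite -/N in N_le N_gt.
have r16_gt0 : 0 < 16 * r by rewrite mulr_gt0.
have N_gt0 : (0 < N)%N.
  rewrite -ltnS -(ltr_nat R) (le_lt_trans _ N_gt)// invf_ge1//.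
  by rewrite mulrC -ler_pdivlMr// div1r.
have NR_gt0 : 0 < N%:R :> R by rewrite ltr0n.
have rN_le : r * N%:R <= 16^-1.
  move: N_le; rewrite -(ler_pM2l r16_gt0) divff ?gt_eqF//.
  by rewrite -mulrA -ler_pdivlMl// mulr1.
have rN_ge : 1 <= 32 * r * N%:R.
  have N_ge1 : 1 <= N%:R :> R by rewrite ler1n.
  move: N_gt; rewrite -(ltr_pM2l r16_gt0) divff ?gt_eqF// -natr1.
  by nra.
apply: le_trans (measure_itv_le_fourier c nu_unit N_gt0 rN_le) _.
rewrite lee_fin; apply: (@le_trans _ _ (8 / N%:R * (C * N%:R `^ (1 - s)))).
  rewrite ler_wpM2l ?divr_ge0// (le_trans _ (sum_le _ N_gt0))//.
  by rewrite big_nat_recr// lerDl; exact: normc_ge0.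
have -> : 8 / N%:R * (C * N%:R `^ (1 - s)) = 8 * C * (N%:R `^ s)^-1.
  rewrite powRB ?powRr1// ?(gt_eqF NR_gt0) ?implybT//.
  by field; rewrite ?gt_eqF ?powR_gt0.
rewrite -[leRHS]mulrA ler_wpM2l ?mulr_ge0// -div1r ler_pdivrMr ?powR_gt0//.
rewrite -!powRM ?mulr_ge0 ?(ltW r_gt0)//.
apply: (@le_trans _ _ (1 `^ s)); first by rewrite powR1.
by rewrite ge0_ler_powR ?nnegrE ?mulr_ge0 ?(ltW r_gt0).
Qed.

Lemma kappa1_le_hausdorff_dim A : {ae nu, forall x, `[0, 1]%classic x} ->
  measurable A -> (0 < nu A)%E -> (kappa1 nu <= hausdorff_dim A)%E.
Proof.
move=> nu_unit mA nuA_gt0; apply: ge_ereal_sup => _ [s [s_ge0 [C sum_le]] <-].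
have nu_unit_gt0 : (0 < nu `[0%R, 1%R]%classic)%E.
  rewrite [ltRHS]measure_ae_full// (lt_le_trans nuA_gt0)//.
  by apply: le_measure; rewrite ?inE.
have C_gt0 : 0 < C.
  have := sum_le 1%N isT; rewrite powR1 mulr1; apply: lt_le_trans.
  rewrite big_nat_recl// big_nat1 ltr_pwDl ?normc_ge0// normc_fourier0.
  by rewrite fine_gt0// nu_unit_gt0 -ge0_fin_numE ?fin_num_measure.
have nu_frostman := frostman_fourier nu_unit s_ge0 (ltW C_gt0) sum_le.
apply: mass_distribution_principle nu_frostman mA nuA_gt0.
  by rewrite !mulr_gt0 ?powR_gt0.
by rewrite invr_gt0.
Qed.

Lemma kappa1_ge0 : (0 <= kappa1 nu)%E.
Proof.
apply: ereal_sup_ubound; exists 0 => //; split => //.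
exists (4 * fine (nu `[0, 1]%classic)) => Q Q_gt0.
rewrite subr0 powRr1//.
apply: (@le_trans _ _ (\sum_(0 <= xi < Q.+1) 2 * fine (nu `[0, 1]%classic))).
  by apply: ler_sum => xi _; exact: normc_fourier_le_mass.
have mass_ge0 : 0 <= fine (nu `[0, 1]%classic) by rewrite fine_ge0.
rewrite sumr_const_nat subn0 -[leLHS]mulr_natr mulrAC [leRHS]mulrAC ler_wpM2r//.
by rewrite -!natrM ler_nat; lia.
Qed.

Lemma kappa1_ge_geometric b (M : R) : (1 < b)%N -> 1 <= M ->
  (forall n, \sum_(0 <= xi < b ^ n) normc (fourier nu xi%:Z) <= M ^+ n) ->
  ((1 - ln M / ln b%:R)%:E <= kappa1 nu)%E.
Proof.
move=> b_gt1 M_ge1 sum_le; set s := 1 - _.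
have bR_gt1 : 1 < b%:R :> R by rewrite ltr1n.
have bR_gt0 : 0 < b%:R :> R by rewrite (lt_trans _ bR_gt1).
have ln_b_gt0 : 0 < ln b%:R :> R by exact: ln_gt0.
have [s_ge0|s_lt0] := leP 0 s; last first.
  by apply: le_trans kappa1_ge0; rewrite lee_fin ltW.
have s_le1 : 0 <= 1 - s by rewrite subKr divr_ge0 ?ln_ge0 ?(ltW bR_gt1).
have powRb : b%:R `^ (1 - s) = M.
  rewrite /powR gt_eqF// subKr divfK ?gt_eqF// lnK// posrE.
  exact: lt_le_trans M_ge1.
apply: ereal_sup_ubound; exists s => //; split => //.
exists (b%:R `^ (1 - s)) => Q Q_gt0; pose n := (trunc_log b Q).+1.
apply: (@le_trans _ _ (\sum_(0 <= xi < b ^ n) normc (fourier nu xi%:Z))).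
  rewrite [leRHS](@big_cat_nat _ _ _ Q.+1)//; last exact: trunc_log_ltn.
  by rewrite lerDl; apply: sumr_ge0 => xi _; exact: normc_ge0.
apply: le_trans (sum_le n) _; rewrite -powRb.
rewrite -powR_mulrn ?powR_ge0// powRAC powR_mulrn ?(ltW bR_gt0)//.
rewrite -powRM ?(ltW bR_gt0)//.
apply: ge0_ler_powR; rewrite ?nnegrE ?exprn_ge0 ?mulr_ge0 ?(ltW bR_gt0)//.
by rewrite exprS ler_wpM2l ?(ltW bR_gt0)// -natrX ler_nat trunc_logP.
Qed.

End fourier_of_measure.

Section missing_digit_dimension.
Context {R : realType}.
Variables (b : nat) (D : {fset nat}).
Hypotheses (b_gt1 : (1 < b)%N) (D_lt : [set` D] `<=` `I_b).

Definition cylinder n (w : {ffun 'I_n -> D}) : set R :=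
  [set x | exists u : nat -> nat, [/\ forall i, u i \in D,
    forall i : 'I_n, u i = val (w i) & x = digit_sum b u]].

Lemma missing_digit_set_cylinders n :
  missing_digit_set b D `<=` \bigcup_(w : {ffun 'I_n -> D}) cylinder w.
Proof.
move=> _ [_ [u [uD ->]]]; exists [ffun i : 'I_n => FSetSub (uD i)] => //.
by exists u; split => // i; rewrite ffunE.
Qed.

Lemma diam_cylinder_le n (w : {ffun 'I_n -> D}) :
  (diam (cylinder w) <= (b%:R ^- n)%:E)%E.
Proof.
apply: ge_ereal_sup => _ [[x y] /= [[u [uD uw ->]] [v [vD vw ->]]] <-].
rewrite lee_fin; apply: digit_sum_dist => // [i|i|i ni].
- exact: D_lt (uD i).
- exact: D_lt (vD i).
- by rewrite (uw (Ordinal ni)) (vw (Ordinal ni)).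
Qed.

Lemma hausdorff_dim_missing_digit_set_le : (0 < #|` D|)%N ->
  (hausdorff_dim (missing_digit_set b D : set R) <=
    (ln #|` D|%fset%:R / ln b%:R)%:E)%E.
Proof.
move=> D_neq0; set s := _ / _.
have bR_gt1 : 1 < b%:R :> R by rewrite ltr1n.
have bR_gt0 : 0 < b%:R :> R by rewrite (lt_trans _ bR_gt1).
have ln_b_gt0 : 0 < ln b%:R :> R by exact: ln_gt0.
have D_ge1 : 1 <= #|` D|%fset%:R :> R by rewrite ler1n.
have powRb : b%:R `^ s = #|` D|%fset%:R.
  rewrite /powR gt_eqF// divfK ?gt_eqF// lnK// posrE.
  exact: lt_le_trans D_ge1.
apply: (@hausdorff_dim_le_covers _ s 1).
  by rewrite divr_ge0 ?ln_ge0 ?(ltW bR_gt1).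
move=> delta delta_gt0; have [n bn_lt] := expV_small b_gt1 delta_gt0.
exists {ffun 'I_n -> D}, (@cylinder n), (b%:R ^- n); split.
- by rewrite invr_gt0 exprn_gt0// ltW.
- exact: missing_digit_set_cylinders.
- exact: diam_cylinder_le.
rewrite card_ffun card_ord -cardfE natrX.
rewrite -(powR_invn _ (ltW bR_gt0)) powRAC powRb.
rewrite powR_invn ?(le_trans _ D_ge1)// divff//.
by rewrite expf_neq0// gt_eqF// (lt_le_trans _ D_ge1).
Qed.

End missing_digit_dimension.

Section arithmetic_digits.
Context {R : realType}.
Variables a d l : nat.
Hypothesis d_gt0 : (0 < d)%N.

Lemma perm_arith_digits :
  perm_eq (arith_digits a d l) [seq (k * d + a)%N | k <- iota 0 l].
Proof.
apply: uniq_perm; first exact: fset_uniq.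
  rewrite map_inj_in_uniq ?iota_uniq// => i j _ _ /eqP.
  by rewrite eqn_add2r eqn_pmul2r// => /eqP.
by move=> x; apply/imfsetP/mapP => /= -[k kl ->]; exists k.
Qed.

Lemma card_arith_digits : #|` arith_digits a d l|%fset = l.
Proof. by rewrite (perm_size perm_arith_digits) size_map size_iota. Qed.

Lemma digit_transform_arith_digits (x : R) :
  digit_transform (arith_digits a d l) x = dirichlet l (d%:R * x) / l%:R.
Proof.
rewrite /digit_transform card_arith_digits; congr (_ / _).
rewrite -(big_seq_fsetE _ _ xpredT (fun k => cexp2pi (- (x * k%:R))))/=.
rewrite (perm_big _ perm_arith_digits) big_map -{1}[l]subn0 big_mkord.
rewrite -dirichletN /dirichlet.
rewrite (eq_bigr (fun k : 'I_l =>
    cexp2pi (- (x * a%:R)) * cexp2pi (k%:R * - (d%:R * x)))).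
  by rewrite -mulr_sumr normcM normc_cexp2pi mul1r.
by move=> k _; rewrite -cexp2piD natrD natrM; congr cexp2pi; ring.
Qed.

Lemma arith_digits_lt b : (0 < l)%N ->
  [set` arith_digits a d l] `<=` `I_b -> (d * l.-1 < b)%N.
Proof.
move=> l_gt0 D_lt; have : (l.-1 * d + a < b)%N.
  apply: D_lt; apply/imfsetP; exists l.-1 => //=.
  by rewrite mem_iota add0n ltn_predL.
by rewrite mulnC; apply: leq_ltn_trans; rewrite leq_addr.
Qed.

End arithmetic_digits.

Section arithmetic_digit_measure.
Context {R : realType} {disp : measure_display} {T : measurableType disp}.
Variables (P : probability T R) (b a d l : nat) (X : nat -> {RV P >-> nat}).
Hypotheses (b_gt1 : (1 < b)%N) (d_gt0 : (0 < d)%N) (l_gt1 : (1 < l)%N).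
Hypothesis D_lt : [set` arith_digits a d l] `<=` `I_b.
Hypothesis X_uniform : forall i, uniform_on (arith_digits a d l) (X i).
Hypothesis X_indep : mutually_independent X.

Let dl_lt_b : (d * l.-1 < b)%N := arith_digits_lt (ltnW l_gt1) D_lt.

Lemma sum_fourier_le n :
  \sum_(0 <= xi < b ^ n) normc (fourier (missing_digit_measure b X) xi%:Z) <=
    (b%:R * (4 + ln (2 * l%:R)) / l%:R) ^+ n.
Proof.
apply: le_trans (@sum_prod_dirichlet_le R l b d n l_gt1 d_gt0 dl_lt_b).
apply: ler_sum => xi _.
apply: le_trans (normc_fourier_le b_gt1 D_lt X_uniform X_indep xi n) _.
rewrite le_eqVlt; apply/predU1l/eq_bigr => i _.
exact: digit_transform_arith_digits.
Qed.

Lemma kappa1_missing_digit_measure_ge :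
  ((ln l%:R / ln b%:R - ln (4 + ln (2 * l%:R)) / ln b%:R)%:E <=
    kappa1 (missing_digit_measure b X))%E.
Proof.
set L := 4 + _; set M := b%:R * L / l%:R.
have lR_gt0 : 0 < l%:R :> R by rewrite ltr0n ltnW.
have bR_gt1 : 1 < b%:R :> R by rewrite ltr1n.
have bR_gt0 : 0 < b%:R :> R by rewrite (lt_trans _ bR_gt1).
have L_ge1 : 1 <= L by rewrite ler_wpDr ?ler1n// ln_ge0// -natrM ler1n; lia.
have L_gt0 : 0 < L by exact: lt_le_trans L_ge1.
have M_ge1 : 1 <= M.
  have l_le_b : l%:R <= b%:R :> R by rewrite ler_nat; have := dl_lt_b; nia.
  by rewrite ler_pdivlMr// mul1r (le_trans l_le_b)// ler_peMr// ltW.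
have := kappa1_ge_geometric b_gt1 M_ge1 sum_fourier_le.
apply: le_trans; rewrite lee_fin le_eqVlt; apply/predU1l.
rewrite ln_div ?posrE ?mulr_gt0// lnM ?posrE//.
by field; rewrite gt_eqF// ln_gt0.
Qed.

End arithmetic_digit_measure.

Theorem theorem2p6 (R : realType) (b a d l : nat)
    (hb : (3 <= b)%N) (hd : (1 <= d)%N) (hl : (2 <= l)%N)
    (hD : [set` arith_digits a d l] `<` `I_b)
    (disp : measure_display) (T : measurableType disp) (P : probability T R)
    (X : nat -> {RV P >-> nat})
    (X_uniform : forall i, uniform_on (arith_digits a d l) (X i))
    (X_indep : mutually_independent X) :
  let nu := missing_digit_measure b X in
  (dimH nu >= kappa1 nu)%E /\
  (kappa1 nu >= dimH nu - (ln (4 + ln (2 * l%:R)) / ln b%:R)%:E)%E.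
Proof.
move=> nu; have b_gt1 : (1 < b)%N := ltnW hb; have D_lt := properW hD.
rewrite /dimH (msupport_missing_digit_measure b_gt1 D_lt X_uniform X_indep).
have mK := @measurable_missing_digit_set R _ _ b_gt1 D_lt.
have K_ae := ae_missing_digit_measure b_gt1 D_lt X_uniform.
split.
  apply: kappa1_le_hausdorff_dim => //.
    by apply: filterS K_ae => x [].
  by rewrite [ltRHS](measure_ae_full mK K_ae) [ltRHS]probability_setT.
apply: le_trans
  (kappa1_missing_digit_measure_ge b_gt1 hd hl D_lt X_uniform X_indep).
rewrite EFinB leeB// -[X in (ln X%:R / _)%:E](card_arith_digits a l hd).
apply: hausdorff_dim_missing_digit_set_le => //.
by rewrite card_arith_digits// ltnW.
Qed.
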